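(* Let $R>0$, $A>0$ and $d\in\left(0,\frac{B_1^2}{B_1^2+5\pi^2/4}\right)$. There exists a constant $C_2>0$ depending only on $G,N,K,A,R,d$ such that the following holds. For $i=1,2$ let $(p_i,q_i)$ be a data pair (as defined in the context) with, moreover, $q_i\ge 0$ on $\partial_1G\times(0,\pi)$, put $p^i(x,y,a)=p_i(x,y,B_2,a)$, and assume $$\|p^i\|_{C^1(\overline{\Gamma}_u\times[0,\pi])}\le A,\qquad \|q_i\|_{C^1(\overline{G}\times[0,\pi])}\le A .$$ Assume that for each $i=1,2$ there is $Q_i\in B(R,q_i,d)$ solving $$Q_i(z)=\mathcal{F}_{p_i,q_i}(Q_i)(z)+\widehat v_0+\widehat q_i(z),\quad z\in[B_1,B_2],\qquad Q_i(B_1)=0,$$ and let $c_i(\mathbf u)$, $\mathbf u\in\overline G$, be the corresponding coefficient, i.e. for all $(\mathbf u,a)\in\overline G\times[0,\pi]$ $$v_{Q_i,q_i}(\mathbf u,a)+\big(E^x_{p_i,q_i,Q_i}(\mathbf u,a)\big)^2+\big(E^y_{p_i,q_i,Q_i}(\mathbf u,a)\big)^2=c_i(\mathbf u).$$ Then $$\|Q_1-Q_2\|_{C[B_1,B_2]}\le C_2\left[\|p^1-p^2\|_{C^1(\overline\Gamma_u\times[0,\pi])}+\|q_1-q_2\|_{C^1(\overline G\times[0,\pi])}\right],$$ $$\|c_1-c_2\|_{C(\overline G)}\le C_2\left[\|p^1-p^2\|_{C^1(\overline\Gamma_u\times[0,\pi])}+\|q_1-q_2\|_{C^1(\overline G\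times[0,\pi])}\right].$$
   Context: Fix throughout $0<B_1<B_2$, integers $N,K\ge1$ and $\beta>0$. Points of $\mathbb R^3$ are $\mathbf u=(x,y,z)$; $G=(0,\pi)^2\times(B_1,B_2)$, $\Gamma_l=\{0<x,y<\pi,\ z=B_1\}$, $\Gamma_u=\{0<x,y<\pi,\ z=B_2\}$, $\partial_1G=\partial G\setminus(\Gamma_l\cup\Gamma_u)$. Basis: $\varphi_0,\dots,\varphi_{N-1}$ are obtained by Gram-Schmidt orthonormalization in $L_2(0,\pi)$ of the functions $(a+\beta)^ne^a$, $n=0,\dots,N-1$. It is a known fact that the $N\times N$ matrix of numbers $\int_0^\pi\varphi_n'\varphi_l\,da$ is invertible. Put $v_0(x,y,a)=\dfrac{B_1^2}{(x-a)^2+(y-\pi/2)^2+B_1^2}$. Data pair $(p,q)$: $p=p(\mathbf u,a)$ is a function on $(\partial G\setminus\Gamma_l)\times[0,\pi]$ (travel time data for the source $(a,\pi/2,0)$), with $p(\cdot,\cdot,B_2,\cdot)\in C^1(\overline\Gamma_u\times[0,\pi])$ and differentiable in $z$ on $\partial_1G\times(0,\pi)$; and $q\in C^1(\overline G\times[0,\pi])$ satisfies $q=\overline p$ on $\partial_1G\times(0,\pi)$, where $\overline p=(\partial_zp)^2-v_0$, and $q(x,y,B_1,a)=0$ for $(x,y,a)\in(0,\pi)^3$. For an $NK^2$-dimensional vector function $Q(z)=(w_{n,km}(z))$, $0\le n\le N-1$, $1\le k,m\le K$, continuous on $[B_1,B_2]$, put $$V_Q(\mathbf u,a)=\sum_{n=0}^{N-1}\sum_{k,m=1}^Kw_{n,km}(z)\varphi_n(a)\sin(kx)\sin(my),\qquad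 v_{Q,q}(\mathbf u,a)=v_0(x,y,a)+q(\mathbf u,a)+V_Q(\mathbf u,a).$$ When $v=v_{Q,q}>0$ on $\overline G\times[0,\pi]$, put $$E^x_{p,q,Q}(x,y,z,a)=-\int_z^{B_2}\frac{v_x}{2\sqrt v}(x,y,s,a)\,ds+p_x(x,y,B_2,a),$$ $$E^y_{p,q,Q}(x,y,z,a)=-\int_z^{B_2}\frac{v_y}{2\sqrt v}(x,y,s,a)\,ds+p_y(x,y,B_2,a).$$ For a function $h(x,y,a)$ on $[0,\pi]^3$ let $\Lambda h=((\Lambda h)_{n,km})\in\mathbb R^{NK^2}$ be the unique solution of $$\frac{\pi^2}{4}\sum_{n=0}^{N-1}\Big(\int_0^\pi\varphi_n'\varphi_l\,da\Big)(\Lambda h)_{n,km}=-\int_0^\pi\!\int_0^\pi\!\int_0^\pi\partial_ah(x,y,a)\sin(kx)\sin(my)\varphi_l(a)\,da\,dx\,dy,$$ for $0\le l\le N-1$, $1\le k,m\le K$; if $h$ is merely continuous, the inner integral $\int_0^\pi\partial_ah\,\varphi_l\,da$ is understood as $[h\varphi_l]_{a=0}^{a=\pi}-\int_0^\pi h\varphi_l'\,da$. Define $$\mathcal F_{p,q}(Q)(z)=\Lambda\big((E^x_{p,q,Q})^2+(E^y_{p,q,Q})^2\big)(z),\qquad\widehat v_0=\Lambda v_0,\qquad\widehat q(z)=\Lambda q(\cdot,\cdot,z,\cdot),$$ where $\Lambda$ is applied in the variables $(x,y,a)$ for fixed $z$; $\widehat q_i$ denotes this for $q=q_i$. Norms of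 vector functions are square roots of sums of squared norms of components. $H_0^1(B_1,B_2)=\{Q\in H^1(B_1,B_2):Q(B_1)=0\}$ ($NK^2$-dimensional vector functions), and $$B(R,q,d)=\{Q\in H_0^1(B_1,B_2):\ \|Q\|_{H^1(B_1,B_2)}<R,\ q+V_Q>-d\text{ on }\overline G\times[0,\pi]\}.$$ Since $v_0\ge B_1^2/(B_1^2+5\pi^2/4)$ on $[0,\pi]^3$, $v_{Q,q}$ is bounded below by a positive constant for $Q\in B(R,q,d)$. *)

(* Defs.v *)
From mathcomp Require Import all_boot all_order all_algebra.
From mathcomp Require Import all_classical all_reals all_analysis.

Set Implicit Arguments.
Unset Strict Implicit.
Unset Printing Implicit Defensive.

Import Order.TTheory GRing.Theory Num.Theory.
Import numFieldNormedType.Exports.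

Local Open Scope classical_set_scope.
Local Open Scope ring_scope.

(* Conventions.  A point (x, y, z) of R^3 and a source position a are passed
   as separate real arguments, in the order x, y, z, a.  A function given on a
   closed set is a total function of which only the values on that set are ever
   used.  The indices k, m >= 1 of sin(kx) sin(my) are represented by
   k, m : 'I_K standing for k.+1, m.+1. *)

(* Derivative relative to [lo, hi]: the usual derivative in the open interval,
   the one-sided derivative at the two end points.  For a function that is C^1
   on a closed box it is the continuous extension of the partial derivative
   from the interior. *)
Definition quot_within {R : realType} (lo hi : R) (f : R -> R) (t : R)
    : set_system R :=
  (fun s => (f s - f t) / (s - t)) @ within `[lo, hi] t^'.

Definition derivable_within {R : realType} (lo hi : R) (f : R -> R) (t : R)
    : Prop :=
  cvg (quot_within lo hi f t).

Definition D_within {R : realType} (lo hi : R) (f : R -> R) (t : R) : R :=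
  lim (quot_within lo hi f t).

(* A real supremum, used only for functions bounded on D (sup is 0 otherwise). *)
Definition supnorm {R : realType} {T : Type} (D : set T) (f : T -> R) : R :=
  sup [set `|f X| | X in D].

Definition box3 {R : realType} (l1 h1 l2 h2 l3 h3 : R) : set (R * R * R) :=
  `[l1, h1] `*` `[l2, h2] `*` `[l3, h3].

Definition box4 {R : realType} (l1 h1 l2 h2 l3 h3 l4 h4 : R)
    : set (R * R * R * R) :=
  `[l1, h1] `*` `[l2, h2] `*` `[l3, h3] `*` `[l4, h4].

Definition unc3 {R : realType} (u : R -> R -> R -> R) (X : R * R * R) : R :=
  u X.1.1 X.1.2 X.2.

Definition unc4 {R : realType} (u : R -> R -> R -> R -> R)
    (X : R * R * R * R) : R :=
  u X.1.1.1 X.1.1.2 X.1.2 X.2.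

(* The closure of Gamma_u times [0, pi], in the variables x, y, a. *)
Definition cube {R : realType} : set (R * R * R) := box3 0 pi 0 pi 0 pi.

Definition dx3 {R : realType} (u : R -> R -> R -> R) : R -> R -> R -> R :=
  fun x y a => D_within 0 pi (fun t => u t y a) x.
Definition dy3 {R : realType} (u : R -> R -> R -> R) : R -> R -> R -> R :=
  fun x y a => D_within 0 pi (fun t => u x t a) y.
Definition da3 {R : realType} (u : R -> R -> R -> R) : R -> R -> R -> R :=
  fun x y a => D_within 0 pi (fun t => u x y t) a.

Definition C1_cube {R : realType} (u : R -> R -> R -> R) : Prop :=
  (forall x y a, cube (x, y, a) ->
     [/\ derivable_within 0 pi (fun t => u t y a) x,
         derivable_within 0 pi (fun t => u x t a) y &
         derivable_within 0 pi (fun t => u x y t) a]) /\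
  [/\ {within cube, continuous (unc3 u)},
      {within cube, continuous (unc3 (dx3 u))},
      {within cube, continuous (unc3 (dy3 u))} &
      {within cube, continuous (unc3 (da3 u))}].

Definition C1norm_cube {R : realType} (u : R -> R -> R -> R) : R :=
  supnorm cube (unc3 u) + supnorm cube (unc3 (dx3 u)) +
  supnorm cube (unc3 (dy3 u)) + supnorm cube (unc3 (da3 u)).

(* The closure of G times [0, pi]. *)
Definition Ga {R : realType} (B1 B2 : R) : set (R * R * R * R) :=
  box4 0 pi 0 pi B1 B2 0 pi.

Definition dx4 {R : realType} (u : R -> R -> R -> R -> R)
    : R -> R -> R -> R -> R :=
  fun x y z a => D_within 0 pi (fun t => u t y z a) x.
Definition dy4 {R : realType} (u : R -> R -> R -> R -> R)
    : R -> R -> R -> R -> R :=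
  fun x y z a => D_within 0 pi (fun t => u x t z a) y.
Definition dz4 {R : realType} (B1 B2 : R) (u : R -> R -> R -> R -> R)
    : R -> R -> R -> R -> R :=
  fun x y z a => D_within B1 B2 (fun t => u x y t a) z.
Definition da4 {R : realType} (u : R -> R -> R -> R -> R)
    : R -> R -> R -> R -> R :=
  fun x y z a => D_within 0 pi (fun t => u x y z t) a.

Definition C1_Ga {R : realType} (B1 B2 : R) (u : R -> R -> R -> R -> R)
    : Prop :=
  (forall x y z a, Ga B1 B2 (x, y, z, a) ->
     [/\ derivable_within 0 pi (fun t => u t y z a) x,
         derivable_within 0 pi (fun t => u x t z a) y,
         derivable_within B1 B2 (fun t => u x y t a) z &
         derivable_within 0 pi (fun t => u x y z t) a]) /\
  [/\ {within Ga B1 B2, continuous (unc4 u)},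
      {within Ga B1 B2, continuous (unc4 (dx4 u))},
      {within Ga B1 B2, continuous (unc4 (dy4 u))},
      {within Ga B1 B2, continuous (unc4 (dz4 B1 B2 u))} &
      {within Ga B1 B2, continuous (unc4 (da4 u))}].

Definition C1norm_Ga {R : realType} (B1 B2 : R) (u : R -> R -> R -> R -> R)
    : R :=
  supnorm (Ga B1 B2) (unc4 u) + supnorm (Ga B1 B2) (unc4 (dx4 u)) +
  supnorm (Ga B1 B2) (unc4 (dy4 u)) + supnorm (Ga B1 B2) (unc4 (dz4 B1 B2 u)) +
  supnorm (Ga B1 B2) (unc4 (da4 u)).

Definition domG {R : realType} (B1 B2 : R) : set (R * R * R) :=
  `]0, pi[ `*` `]0, pi[ `*` `]B1, B2[.

Definition closG {R : realType} (B1 B2 : R) : set (R * R * R) :=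
  box3 0 pi 0 pi B1 B2.

Definition Gamma_at {R : realType} (z : R) : set (R * R * R) :=
  `]0, pi[ `*` `]0, pi[ `*` [set z].

Definition boundary1 {R : realType} (B1 B2 : R) : set (R * R * R) :=
  (closG B1 B2 `\` domG B1 B2) `\` (Gamma_at B1 `|` Gamma_at B2).

Definition L2dot {R : realType} (lo hi : R) (f g : R -> R) : R :=
  \int[lebesgue_measure]_(t in `[lo, hi]) (f t * g t).

Fixpoint gram_schmidt {R : realType} (dot : (R -> R) -> (R -> R) -> R)
    (e : nat -> R -> R) (n : nat) : seq (R -> R) :=
  if n is j.+1 then
    let s := gram_schmidt dot e j in
    let u := fun a => e j a - \sum_(f <- s) dot (e j) f * f a in
    rcons s (fun a => u a / Num.sqrt (dot u u))
  else [::].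

Definition phi {R : realType} (beta : R) (n : nat) : R -> R :=
  nth (fun=> 0)
    (gram_schmidt (L2dot 0 pi) (fun j a => (a + beta) ^+ j * expR a) n.+1) n.

Definition v0 {R : realType} (B1 : R) (x y a : R) : R :=
  B1 ^+ 2 / ((x - a) ^+ 2 + (y - pi / 2) ^+ 2 + B1 ^+ 2).

Definition VQ {R : realType} (N K : nat) (beta : R)
    (Q : R -> 'I_N -> 'I_K -> 'I_K -> R) (x y z a : R) : R :=
  \sum_(n < N) \sum_(k < K) \sum_(m < K)
    Q z n k m * phi beta n a * sin (k.+1%:R * x) * sin (m.+1%:R * y).

Definition vQq {R : realType} (N K : nat) (B1 beta : R)
    (q : R -> R -> R -> R -> R) (Q : R -> 'I_N -> 'I_K -> 'I_K -> R)
    (x y z a : R) : R :=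
  v0 B1 x y a + q x y z a + VQ beta Q x y z a.

Definition Ex {R : realType} (N K : nat) (B1 B2 beta : R)
    (p q : R -> R -> R -> R -> R) (Q : R -> 'I_N -> 'I_K -> 'I_K -> R)
    (x y z a : R) : R :=
  let v := vQq B1 beta q Q in
  - (\int[lebesgue_measure]_(s in `[z, B2])
       (dx4 v x y s a / (2 * Num.sqrt (v x y s a))))
  + dx4 p x y B2 a.

Definition Ey {R : realType} (N K : nat) (B1 B2 beta : R)
    (p q : R -> R -> R -> R -> R) (Q : R -> 'I_N -> 'I_K -> 'I_K -> R)
    (x y z a : R) : R :=
  let v := vQq B1 beta q Q in
  - (\int[lebesgue_measure]_(s in `[z, B2])
       (dy4 v x y s a / (2 * Num.sqrt (v x y s a))))
  + dy4 p x y B2 a.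

(* The inner integral of (d/da h) phi_l over [0, pi], for h = h(a): the classical
   one, and its meaning by parts when h is merely continuous. *)
Definition inner_C1 {R : realType} (beta : R) (l : nat) (h : R -> R) : R :=
  \int[lebesgue_measure]_(a in `[0, pi]) (D_within 0 pi h a * phi beta l a).

Definition inner_C0 {R : realType} (beta : R) (l : nat) (h : R -> R) : R :=
  (h pi * phi beta l pi - h 0 * phi beta l 0)
  - \int[lebesgue_measure]_(a in `[0, pi]) (h a * derive1 (phi beta l) a).

Definition Lambda_mx {R : realType} (N : nat) (beta : R) : 'M[R]_N :=
  \matrix_(l < N, n < N)
    (pi ^+ 2 / 4 * L2dot 0 pi (fun a => derive1 (phi beta n) a) (phi beta l)).

(* [inner] is the reading of the inner integral, [inner_C1] or [inner_C0].
   The matrix is invertible: the derivative of phi_n is phi_n plus a combination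
   of phi_j, j < n, so up to the factor pi^2/4 it is unitriangular. *)
Definition Lambda {R : realType} (N K : nat) (beta : R)
    (inner : R -> nat -> (R -> R) -> R) (h : R -> R -> R -> R)
    (n : 'I_N) (k m : 'I_K) : R :=
  (invmx (Lambda_mx N beta) *m
   \col_(l < N)
     - (\int[lebesgue_measure]_(y in `[0, pi])
          (\int[lebesgue_measure]_(x in `[0, pi])
             (inner beta l (h x y) * sin (k.+1%:R * x) * sin (m.+1%:R * y)))))
  n 0.

(* q is only C^1, so that (E^x)^2 + (E^y)^2, which contains q_x and q_y, is in
   general merely continuous in a. *)
Definition Fpq {R : realType} (N K : nat) (B1 B2 beta : R)
    (p q : R -> R -> R -> R -> R) (Q : R -> 'I_N -> 'I_K -> 'I_K -> R) (z : R)
    : 'I_N -> 'I_K -> 'I_K -> R :=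
  Lambda beta inner_C0 (fun x y a =>
    Ex B1 B2 beta p q Q x y z a ^+ 2 + Ey B1 B2 beta p q Q x y z a ^+ 2).

Definition v0hat {R : realType} (N K : nat) (B1 beta : R)
    : 'I_N -> 'I_K -> 'I_K -> R :=
  Lambda beta inner_C1 (v0 B1).

Definition qhat {R : realType} (N K : nat) (beta : R)
    (q : R -> R -> R -> R -> R) (z : R) : 'I_N -> 'I_K -> 'I_K -> R :=
  Lambda beta inner_C1 (fun x y a => q x y z a).

Definition data_pair {R : realType} (B1 B2 : R) (p q : R -> R -> R -> R -> R)
    : Prop :=
  [/\ C1_cube (fun x y a => p x y B2 a),
      (forall x y z a, boundary1 B1 B2 (x, y, z) -> 0 < a < pi ->
         derivable_within B1 B2 (fun t => p x y t a) z),
      C1_Ga B1 B2 q,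
      (forall x y z a, boundary1 B1 B2 (x, y, z) -> 0 < a < pi ->
         q x y z a = dz4 B1 B2 p x y z a ^+ 2 - v0 B1 x y a) &
      (forall x y a, 0 < x < pi -> 0 < y < pi -> 0 < a < pi ->
         q x y B1 a = 0)].

Definition smooth_test {R : realType} (B1 B2 : R) (f : R -> R) : Prop :=
  (forall (n : nat) (t : R), derivable (derive1n n f) t 1) /\
  (exists s1 s2 : R, [/\ B1 < s1, s2 < B2 &
     forall t, t \notin `[s1, s2] -> f t = 0]).

Definition L2 {R : realType} (B1 B2 : R) (f : R -> R) : Prop :=
  measurable_fun `[B1, B2] f /\
  lebesgue_measure.-integrable `[B1, B2] (fun t => (f t ^+ 2)%:E).

Definition weak_derivative {R : realType} (B1 B2 : R) (w g : R -> R) : Prop :=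
  L2 B1 B2 g /\
  forall f, smooth_test B1 B2 f ->
    \int[lebesgue_measure]_(t in `[B1, B2]) (w t * derive1 f t) =
    - \int[lebesgue_measure]_(t in `[B1, B2]) (g t * f t).

Definition H1 {R : realType} (B1 B2 : R) (w : R -> R) : Prop :=
  L2 B1 B2 w /\ exists g, weak_derivative B1 B2 w g.

(* The weak derivative is unique almost everywhere; any choice of it gives the
   same norm. *)
Definition H1norm {R : realType} (B1 B2 : R) (w : R -> R) : R :=
  let g := xget (fun=> 0) [set g | weak_derivative B1 B2 w g] in
  Num.sqrt (L2dot B1 B2 w w + L2dot B1 B2 g g).

Definition vec_norm {R : realType} (N K : nat) (norm : (R -> R) -> R)
    (Q : R -> 'I_N -> 'I_K -> 'I_K -> R) : R :=
  Num.sqrt (\sum_(n < N) \sum_(k < K) \sum_(m < K)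
    norm (fun z => Q z n k m) ^+ 2).

Definition ball_Rqd {R : realType} (N K : nat) (B1 B2 beta rad : R)
    (q : R -> R -> R -> R -> R) (d : R) (Q : R -> 'I_N -> 'I_K -> 'I_K -> R)
    : Prop :=
  [/\ (forall n k m,
         [/\ {within `[B1, B2], continuous (fun z => Q z n k m)},
             H1 B1 B2 (fun z => Q z n k m) & Q B1 n k m = 0]),
      vec_norm (H1norm B1 B2) Q < rad &
      (forall x y z a, Ga B1 B2 (x, y, z, a) ->
         - d < q x y z a + VQ beta Q x y z a)].

Definition solution {R : realType} (N K : nat) (B1 B2 beta : R)
    (p q : R -> R -> R -> R -> R) (Q : R -> 'I_N -> 'I_K -> 'I_K -> R)
    : Prop :=
  (forall z, B1 <= z <= B2 -> forall n k m,
     Q z n k m = Fpq B1 B2 beta p q Q z n k m + v0hat B1 beta n k m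
                 + qhat beta q z n k m) /\
  (forall n k m, Q B1 n k m = 0).

Definition coefficient {R : realType} (N K : nat) (B1 B2 beta : R)
    (p q : R -> R -> R -> R -> R) (Q : R -> 'I_N -> 'I_K -> 'I_K -> R)
    (c : R -> R -> R -> R) : Prop :=
  forall x y z a, Ga B1 B2 (x, y, z, a) ->
    vQq B1 beta q Q x y z a + Ex B1 B2 beta p q Q x y z a ^+ 2
    + Ey B1 B2 beta p q Q x y z a ^+ 2 = c x y z.

(* Main.v *)
Require Import Defs.
From mathcomp Require Import all_boot all_order all_algebra.
From mathcomp Require Import all_classical all_reals all_analysis.
From mathcomp Require Import ring lra.

Set Implicit Arguments.
Unset Strict Implicit.
Unset Printing Implicit Defensive.

Import Order.TTheory GRing.Theory Num.Theory.
Import numFieldNormedType.Exports.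

Local Open Scope classical_set_scope.
Local Open Scope ring_scope.

(** The equation for [Q] is of Volterra type from the right end: at height [z] the
    functions [E^x], [E^y] contain [Q] only through an integral over [[z, B2]].  If
    [D z] denotes the l1 distance of [Q1 z] and [Q2 z] and [e] the distance of the
    data, then the difference of the two equations gives
    [D z <= C e + C int_z^B2 D], and a Gronwall argument ([gronwall_backward]) yields
    [D <= C e].  The coefficients are compared by inserting this bound into their
    definition at one source position.

    To get the integral inequality, note that [(v, w) |-> w / (2 sqrt v)] is Lipschitz
    where [v] is bounded below and [w] is bounded ([quot_sqrt_dist_le]), and that the
    difference of the two functions [v], and of their derivatives, is at most
    [e + C D].  Squaring [E] costs a bound for [E], and [Lambda] is bounded from the
    sup norm ([Lambda_C0_dist_le], [Lambda_C1_dist_le]): after the integration by parts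
    it contains no derivative of [(E^x)^2 + (E^y)^2].

    The a priori bounds need no Sobolev embedding.  The [H^1] norm dominates the [L^2]
    norm, so [int |Q|] is bounded ([Rintegral_norm_H1]).  This bounds [E], as the
    integrand is at most linear in [Q]; the equation then bounds [Q] pointwise
    ([norm1_Q_le]), and with it the derivatives of [v].

    The constant must not depend on [beta].  It depends on the basis only through
    bounds for [phi], for the inverse matrix and for [Lambda v0], and the basis is in
    fact independent of [beta] ([phi_shift]): Gram-Schmidt turns any sequence of
    functions [P_n(a) exp a], with [P_n] monic of degree [n], into the same orthonormal
    family. *)

(** * Continuity of compound expressions *)

(** These forms unify with an explicit [fun x => f x + g x], and [T] can be a product
    as well as a subspace, so that they also prove continuity within a set. *)
Lemma cont_id (T : topologicalType) : continuous (fun x : T => x).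
Proof. by move=> x. Qed.

Lemma cont_cst (T U : topologicalType) (c : U) : continuous (fun _ : T => c).
Proof. by move=> x; exact: cvg_cst. Qed.

Lemma contD (R : realType) (T : topologicalType) (f g : T -> R) :
  continuous f -> continuous g -> continuous (fun x => f x + g x).
Proof. by move=> cf cg x; exact: cvgD (cf x) (cg x). Qed.

Lemma contB (R : realType) (T : topologicalType) (f g : T -> R) :
  continuous f -> continuous g -> continuous (fun x => f x - g x).
Proof. by move=> cf cg x; exact: cvgB (cf x) (cg x). Qed.

Lemma contM (R : realType) (T : topologicalType) (f g : T -> R) :
  continuous f -> continuous g -> continuous (fun x => f x * g x).
Proof. by move=> cf cg x; exact: cvgM (cf x) (cg x). Qed.

Lemma contN (R : realType) (T : topologicalType) (f : T -> R) :
  continuous f -> continuous (fun x => - f x).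
Proof. by move=> cf x; exact: cvgN (cf x). Qed.

Lemma contV (R : realType) (T : topologicalType) (f : T -> R) :
  continuous f -> (forall x, f x != 0) -> continuous (fun x => (f x)^-1).
Proof. by move=> cf f0 x; exact: cvgV (f0 x) (cf x). Qed.

Lemma contX (R : realType) (T : topologicalType) (f : T -> R) :
  continuous f -> continuous (fun x => f x ^+ 2).
Proof.
by move=> cf; under eq_fun do rewrite expr2; exact: contM.
Qed.

Lemma cont_comp (U V W : topologicalType) (g : V -> W) (f : U -> V) :
  continuous g -> continuous f -> continuous (fun x => g (f x)).
Proof. by move=> cg cf x; apply: continuous_comp (cf x) (cg _). Qed.

Lemma cont_pair (U V W : topologicalType) (f : U -> V) (g : U -> W) :
  continuous f -> continuous g -> continuous (fun x => (f x, g x)).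
Proof. by move=> cf cg x; exact: cvg_pair (cf x) (cg x). Qed.

Lemma cont_fst (U V W : topologicalType) (f : U -> V * W) :
  continuous f -> continuous (fun x => (f x).1).
Proof. by move=> cf x; apply: cvg_comp (cf x) _; exact: cvg_fst. Qed.

Lemma cont_snd (U V W : topologicalType) (f : U -> V * W) :
  continuous f -> continuous (fun x => (f x).2).
Proof. by move=> cf x; apply: cvg_comp (cf x) _; exact: cvg_snd. Qed.

Lemma cont_norm (R : realType) (T : topologicalType) (f : T -> R) :
  continuous f -> continuous (fun x => `|f x|).
Proof. by move=> cf x; exact: cvg_norm (cf x). Qed.

Lemma cont_sum (R : realType) (T : topologicalType) (I : Type) (r : seq I)
    (f : I -> T -> R) :
  (forall i, continuous (f i)) -> continuous (fun x => \sum_(i <- r) f i x).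
Proof.
move=> cf; elim: r => [|i r ih].
  by under eq_fun do rewrite big_nil; exact: cst_continuous.
by under eq_fun do rewrite big_cons; exact: contD.
Qed.

(** * Integrals over a segment and a Gronwall inequality *)

Lemma integrable_seg (R : realType) (a b : R) (f : R -> R) :
  {within `[a, b], continuous f} ->
  lebesgue_measure.-integrable `[a, b] (EFin \o f).
Proof.
by move=> cf; apply: continuous_compact_integrable => //; exact: segment_compact.
Qed.

Lemma Rintegral_cst_seg (R : realType) (a b r : R) : a <= b ->
  \int[lebesgue_measure]_(_ in `[a, b]) r = r * (b - a).
Proof.
move=> ab; rewrite Rintegral_cst//; congr (_ * _).
rewrite -[X in fine X]/(lebesgue_measure [set` `[a, b]]) lebesgue_measure_itv/= lte_fin.
by case: ltgtP ab => // -> _; rewrite subrr.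
Qed.

Lemma Rintegral_dist_le (R : realType) (a b : R) (f g h : R -> R) :
  {within `[a, b], continuous f} -> {within `[a, b], continuous g} ->
  {within `[a, b], continuous h} ->
  (forall t, a <= t <= b -> `|f t - g t| <= h t) ->
  `| \int[lebesgue_measure]_(t in `[a, b]) f t
     - \int[lebesgue_measure]_(t in `[a, b]) g t |
  <= \int[lebesgue_measure]_(t in `[a, b]) h t.
Proof.
move=> cf cg ch fgh.
have cfg : {within `[a, b], continuous (fun t => f t - g t)}.
  exact: contB cf cg.
rewrite -RintegralB//; [|exact: integrable_seg..].
apply: le_trans (le_normr_Rintegral _ _) _ => //; first exact: integrable_seg.
apply: le_Rintegral => //; try exact: integrable_seg.
by apply: integrable_seg; exact: cont_norm cfg.
Qed.

Lemma Rintegral_dist_le_cst (R : realType) (a b e : R) (f g : R -> R) :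
  a <= b ->
  {within `[a, b], continuous f} -> {within `[a, b], continuous g} ->
  (forall t, a <= t <= b -> `|f t - g t| <= e) ->
  `| \int[lebesgue_measure]_(t in `[a, b]) f t
     - \int[lebesgue_measure]_(t in `[a, b]) g t | <= e * (b - a).
Proof.
move=> ab cf cg fge; rewrite -Rintegral_cst_seg//.
by apply: Rintegral_dist_le => // x; exact: cst_continuous.
Qed.

Lemma Rintegral_expR_le (R : realType) (l z b : R) : 0 < l -> z <= b ->
  \int[lebesgue_measure]_(s in `[z, b]) expR (l * (b - s))
  <= expR (l * (b - z)) / l.
Proof.
move=> l0; rewrite le_eqVlt => /predU1P[->|zb].
  by rewrite set_itv1 Rintegral_set1 divr_ge0 ?expR_ge0 ?ltW.
pose F (s : R) := - (expR (l * (b - s)) / l).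
have dF (s : R) : is_derive s (1 : R) F (expR (l * (b - s))).
  rewrite /F; apply: is_derive_eq.
  rewrite /= scaler0 !add0r /GRing.scale/=.
  by field; rewrite gt_eqF.
have cF : continuous F.
  by move=> s; apply/differentiable_continuous/derivable1_diffP; exact: ex_derive.
have cf : continuous (fun s => expR (l * (b - s))).
  apply: (cont_comp (@continuous_expR R)); apply: contM; first exact: cont_cst.
  by apply: contB; [exact: cont_cst|exact: cont_id].
rewrite /Rintegral (@continuous_FTC2 _ _ F)//.
- by rewrite -EFinB /= /F subrr mulr0 expR0 opprK addrC gerDl oppr_le0 divr_ge0// ltW.
- exact: continuous_subspaceT.
- split.
  + by move=> x _; exact: ex_derive.
  + by apply: cvg_at_right_filter; exact: cF.
  + by apply: cvg_at_left_filter; exact: cF.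
- by move=> s _; rewrite derive1E; exact: derive_val.
Qed.

(** Multiplying [w] by the weight [expR (- l (b - z))] turns the
    integral operator into one of norm at most [k / l]; for [l = 2 k] the maximum of
    the weighted function absorbs the integral term. *)
Lemma gronwall_backward (R : realType) (a b c k : R) (w : R -> R) :
  a <= b -> 0 < k ->
  {within `[a, b], continuous w} ->
  (forall z, a <= z <= b ->
     w z <= c + k * \int[lebesgue_measure]_(s in `[z, b]) w s) ->
  forall z, a <= z <= b -> w z <= 2 * `|c| * expR (2 * k * (b - a)).
Proof.
move=> ab k0 cw hw z zab.
pose l := 2 * k.
have l0 : 0 < l by rewrite mulr_gt0.
pose W z := w z * expR (- (l * (b - z))).
have cexp : continuous (fun s => expR (l * (b - s))).
  apply: (cont_comp (@continuous_expR R)); apply: contM; first exact: cont_cst.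
  by apply: contB; [exact: cont_cst|exact: cont_id].
have cW : {within `[a, b], continuous W}.
  apply: contM; first exact: cw.
  apply: continuous_subspaceT.
  under eq_fun do rewrite expRN.
  by apply: contV => // s; rewrite gt_eqF ?expR_gt0.
have [m mab mW] := EVT_max ab cW.
have {}mab : a <= m <= b by move: mab; rewrite in_itv.
have wW s : w s = W s * expR (l * (b - s)).
  by rewrite /W -mulrA -expRD addNr expR0 mulr1.
have Wm : W m <= 2 * `|c|.
  have [Wm0|Wm0] := leP (W m) 0.
    by apply: le_trans Wm0 _; rewrite mulr_ge0.
  have /andP[am mb] := mab.
  have sub : [set` `[m, b]] `<=` [set` `[a, b]].
    by apply: subset_itvr; rewrite bnd_simp.
  have hi : \int[lebesgue_measure]_(s in `[m, b]) w s
      <= W m * (expR (l * (b - m)) / l).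
    apply: (@le_trans _ _
        (\int[lebesgue_measure]_(s in `[m, b]) (W m * expR (l * (b - s))))).
      apply: le_Rintegral => //.
      - by apply: integrable_seg; exact: continuous_subspaceW sub _.
      - apply: integrable_seg; apply: continuous_subspaceT.
        by apply: contM cexp; exact: cont_cst.
      - move=> s sm; rewrite wW ler_wpM2r ?expR_ge0// mW//.
        exact: sub.
    rewrite RintegralZl//; last first.
      by apply: integrable_seg; exact: continuous_subspaceT.
    by rewrite ler_pM2l//; exact: Rintegral_expR_le.
  have E1 : 1 <= expR (l * (b - m)).
    by rewrite -expR0 ler_expR mulr_ge0 ?subr_ge0// ltW.
  have := hw m mab; rewrite wW => h1.
  have h2 : k * \int[lebesgue_measure]_(s in `[m, b]) w s
      <= W m * expR (l * (b - m)) / 2.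
    apply: le_trans (ler_wpM2l (ltW k0) hi) _.
    by rewrite le_eqVlt; apply/orP; left; apply/eqP; rewrite /l; field; rewrite gt_eqF.
  have h3 : W m * expR (l * (b - m)) <= 2 * c by lra.
  have h4 : W m <= W m * expR (l * (b - m)) by rewrite ler_pMr.
  by have := ler_norm c; lra.
have Wz : W z <= 2 * `|c| by apply: le_trans Wm; apply: mW; rewrite in_itv.
rewrite wW; apply: le_trans (ler_wpM2r (expR_ge0 _) Wz) _.
rewrite ler_wpM2l ?mulr_ge0// ler_expR ler_pM2l//.
by have /andP[az _] := zab; lra.
Qed.
Lemma within_comp (U V W : topologicalType) (C : set U) (D : set V) (g : V -> W)
    (f : U -> V) :
  {within D, continuous g} -> {within C, continuous f} ->
  (forall x, C x -> D (f x)) ->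
  {within C, continuous (fun x => g (f x))}.
Proof.
move=> /subspace_continuousP cg /subspace_continuousP cf CD.
apply/subspace_continuousP => x Cx.
apply: cvg_comp (cg _ (CD _ Cx)) => A hA.
have fA : within C (nbhs x) (f @^-1` (fun y => D y -> A y)) := cf x Cx _ hA.
rewrite /nbhs/= /within/= in fA *.
by apply: filterS fA => y yA Cy; apply: yA => //; exact: CD.
Qed.

(** A tube argument: on the compact segment the convergence of [F x s] to [F x0 s]
    as [x] tends to [x0] is uniform in [s]. *)
Lemma within_Rintegral_param (R : realType) (T : topologicalType) (A : set T)
    (a b : R) (F : T -> R -> R) : a <= b ->
  {within A `*` `[a, b], continuous (fun X : T * R => F X.1 X.2)} ->
  {within A, continuous (fun x => \int[lebesgue_measure]_(s in `[a, b]) F x s)}.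
Proof.
move=> ab cF.
have cFx x : A x -> {within `[a, b], continuous (F x)}.
  move=> Ax.
  have cp : {within `[a, b], continuous (fun s : R => (x, s))}.
    by apply: continuous_subspaceT; exact: cont_pair (cont_cst (c := x)) (@cont_id R).
  by apply: (within_comp cF cp) => s sab; split.
apply/subspace_continuousP => x0 Ax0.
apply/cvgrPdist_le => /= e e0.
pose e' := e / (b - a + 1).
have ba1 : 0 < b - a + 1 by rewrite ltr_pwDr// subr_ge0.
have e'0 : 0 < e' by rewrite divr_gt0.
pose P x s := s \in `[a, b] -> A x -> `|F x0 s - F x s| <= e'.
have := @segment_compact R a b; rewrite compact_near_coveringP.
move=> /(_ T (nbhs x0) P _) nc.
have {nc} : \forall x \near x0, `[a, b] `<=` P x.
  apply: nc => s sab.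
  have e2 : 0 < e' / 2 by rewrite divr_gt0.
  move/subspace_continuousP : cF => /(_ (x0, s)) /(_ (conj Ax0 sab)).
  move/cvgrPdist_le => /(_ _ e2); rewrite near_withinE => n1.
  have c1 : continuous (fun X : R * T => (X.2, X.1)).
    exact: cont_pair (cont_snd (@cont_id _)) (cont_fst (@cont_id _)).
  have c2 : continuous (fun X : R * T => (x0, X.1)).
    exact: cont_pair (cont_cst (c := x0)) (cont_fst (@cont_id _)).
  have h1 := c1 (s, x0) _ n1; have h2 := c2 (s, x0) _ n1.
  near=> X => Xab AX.
  have k1 : (A `*` `[a, b])%classic (X.2, X.1) -> `|F x0 s - F X.2 X.1| <= e' / 2.
    by near: X; exact: h1.
  have k2 : (A `*` `[a, b])%classic (x0, X.1) -> `|F x0 s - F x0 X.1| <= e' / 2.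
    by near: X; exact: h2.
  have {}k1 := k1 (conj AX Xab); have {}k2 := k2 (conj Ax0 Xab).
  rewrite (_ : F x0 X.1 - _ = (F x0 s - F X.2 X.1) - (F x0 s - F x0 X.1)); last by ring.
  by apply: le_trans (ler_normB _ _) _; lra.
rewrite near_withinE; apply: filterS => x hx Ax.
apply: le_trans (Rintegral_dist_le_cst ab (cFx x0 Ax0) (cFx x Ax) (e := e') _) _.
  by move=> t tab; apply: hx; rewrite /= ?in_itv.
rewrite /e' mulrAC ler_pdivrMr// ler_pM2l//.
by rewrite lerDl.
Unshelve. all: by end_near. Qed.

(** * The derivative relative to an interval *)

Lemma quot_within_proper (R : realType) (lo hi t : R) : lo < hi ->
  lo <= t <= hi -> ProperFilter (within `[lo, hi] t^').
Proof.
move=> lh /andP[lt th].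
have F : Filter (within `[lo, hi] t^') by apply: within_filter.
split => //.
(* Points of the segment other than t lie arbitrarily close to t, on the side on
   which the segment extends beyond t. *)
rewrite /within/= => /nbhs_ballP[e /= e0 he].
have [tl|tl] := ltP t hi.
- pose s := t + Num.min (e / 2) (hi - t).
  have m0 : 0 < Num.min (e / 2) (hi - t) by rewrite lt_min divr_gt0// subr_gt0.
  have m1 : Num.min (e / 2) (hi - t) <= e / 2 by rewrite ge_min lexx.
  have m2 : Num.min (e / 2) (hi - t) <= hi - t by rewrite ge_min lexx orbT.
  apply: (he s).
  + by rewrite /ball/= /s opprD addrA subrr sub0r normrN gtr0_norm//; lra.
  + by rewrite /s; apply/eqP; lra.
  + by rewrite /= in_itv/= /s; apply/andP; split; lra.
- pose s := t - Num.min (e / 2) (t - lo).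
  have ? : lo < t by apply: lt_le_trans tl.
  have m0 : 0 < Num.min (e / 2) (t - lo) by rewrite lt_min divr_gt0// subr_gt0.
  have m1 : Num.min (e / 2) (t - lo) <= e / 2 by rewrite ge_min lexx.
  have m2 : Num.min (e / 2) (t - lo) <= t - lo by rewrite ge_min lexx orbT.
  apply: (he s).
  + by rewrite /ball/= /s opprB addrC subrK gtr0_norm//; lra.
  + by rewrite /s; apply/eqP; lra.
  + by rewrite /= in_itv/= /s; apply/andP; split; lra.
Qed.

Lemma D_withinE (R : realType) (lo hi t l : R) (f : R -> R) : lo < hi ->
  lo <= t <= hi -> quot_within lo hi f t --> l -> D_within lo hi f t = l.
Proof.
move=> lh tlh fl; have := quot_within_proper lh tlh => PF.
exact: cvg_lim.
Qed.

Lemma quot_within_cvgD (R : realType) (lo hi t l1 l2 : R) (f g : R -> R) :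
  quot_within lo hi f t --> l1 -> quot_within lo hi g t --> l2 ->
  quot_within lo hi (fun s => f s + g s) t --> l1 + l2.
Proof.
move=> fl gl.
have F : Filter (within `[lo, hi] t^') by apply: within_filter.
rewrite /quot_within (_ : (fun s => _) =
    (fun s => (f s - f t) / (s - t) + (g s - g t) / (s - t))).
  exact: cvgD fl gl.
by apply/funext => s; rewrite -mulrDl; congr (_ / _); ring.
Qed.

Lemma quot_within_cvgZ (R : realType) (lo hi t l k : R) (f : R -> R) :
  quot_within lo hi f t --> l ->
  quot_within lo hi (fun s => k * f s) t --> k * l.
Proof.
move=> fl.
have F : Filter (within `[lo, hi] t^') by apply: within_filter.
rewrite /quot_within (_ : (fun s => _) = (fun s => k * ((f s - f t) / (s - t)))).
  by apply: cvgM fl; exact: cvg_cst.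
by apply/funext => s; rewrite mulrA mulrBr.
Qed.

Lemma quot_within_cvgB (R : realType) (lo hi t l1 l2 : R) (f g : R -> R) :
  quot_within lo hi f t --> l1 -> quot_within lo hi g t --> l2 ->
  quot_within lo hi (fun s => f s - g s) t --> l1 - l2.
Proof.
move=> fl gl.
have F : Filter (within `[lo, hi] t^') by apply: within_filter.
rewrite /quot_within (_ : (fun s => _) =
    (fun s => (f s - f t) / (s - t) - (g s - g t) / (s - t))).
  exact: cvgB fl gl.
by apply/funext => s; rewrite -mulrBl; congr (_ / _); ring.
Qed.

Lemma quot_within_cvg_sum (R : realType) (lo hi t : R) (I : Type) (r : seq I)
    (l : I -> R) (f : I -> R -> R) :
  (forall i, quot_within lo hi (f i) t --> l i) ->
  quot_within lo hi (fun s => \sum_(i <- r) f i s) t --> \sum_(i <- r) l i.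
Proof.
move=> fl; elim: r => [|i r ih].
  rewrite big_nil (_ : (fun s => _) = fun=> 0); last first.
    by apply/funext => s; rewrite big_nil.
  rewrite /quot_within (_ : (fun s => _) = fun=> 0); first exact: cvg_cst.
  by apply/funext => s; rewrite subrr mul0r.
rewrite big_cons (_ : (fun s => _) = fun s => f i s + \sum_(j <- r) f j s).
  exact: quot_within_cvgD.
by apply/funext => s; rewrite big_cons.
Qed.

Lemma quot_within_is_derive (R : realType) (lo hi t l : R) (f : R -> R) :
  is_derive t (1 : R) f l -> quot_within lo hi f t --> l.
Proof.
case=> df dl.
have fl : (fun h => h^-1 *: ((f \o shift t) (h *: (1 : R)) - f t)) @ 0^' --> l.
  by rewrite -dl; exact: df.
move/cvgrPdist_le : fl => fl; apply/cvgrPdist_le => e e0.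
have := fl e e0.
rewrite /within /=; move=> /nbhs_ballP[d /= d0 hd]; apply/nbhs_ballP.
exists d => //= s sd st _.
have := hd (s - t); rewrite /= /shift/= /GRing.scale/= mulr1 subrK mulrC; apply.
  by move: sd; rewrite /ball/= sub0r normrN distrC.
by rewrite subr_eq0.
Qed.

(** * Supremum norms on compact sets *)

Lemma supnorm_ub (R : realType) (T : topologicalType) (D : set T) (f : T -> R) X :
  compact D -> {within D, continuous f} -> D X -> `|f X| <= supnorm D f.
Proof.
move=> cD cf DX; rewrite /supnorm; apply: ub_le_sup; last by exists X.
have /compact_bounded[M [_ hM]] := continuous_compact cf cD.
exists (M + 1) => _ [Y DY <-]; apply: (hM (M + 1)); first by rewrite ltrDl.
by exists Y.
Qed.

Lemma supnorm_le (R : realType) (T : Type) (D : set T) (f : T -> R) (M : R) :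
  0 <= M -> (forall X, D X -> `|f X| <= M) -> supnorm D f <= M.
Proof.
move=> M0 hM; rewrite /supnorm.
have [->|/set0P[X DX]] := eqVneq D set0; first by rewrite image_set0 sup0.
by apply: ge_sup; [exists `|f X|, X|move=> _ [Y DY <-]; exact: hM].
Qed.

Lemma supnorm_ge0 (R : realType) (T : Type) (D : set T) (f : T -> R) :
  0 <= supnorm D f.
Proof.
have [[[y [X DX _]] hD]|h] := pselect (has_sup [set `|f X| | X in D]).
  by apply: le_trans (normr_ge0 (f X)) _; apply: ub_le_sup => //; exists X.
(* The supremum of an unbounded set is 0. *)
by rewrite /supnorm sup_out.
Qed.

Lemma compact_box3 (R : realType) (l1 h1 l2 h2 l3 h3 : R) :
  compact (box3 l1 h1 l2 h2 l3 h3).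
Proof. by do !apply: compact_setX; exact: segment_compact. Qed.

Lemma compact_box4 (R : realType) (l1 h1 l2 h2 l3 h3 l4 h4 : R) :
  compact (box4 l1 h1 l2 h2 l3 h3 l4 h4).
Proof. by do !apply: compact_setX; exact: segment_compact. Qed.

Lemma cubeE (R : realType) (x y a : R) :
  cube (x, y, a) <-> [/\ 0 <= x <= pi, 0 <= y <= pi & 0 <= a <= pi].
Proof. by rewrite /cube /box3 /= !in_itv/=; split=> [[[]]|[]]. Qed.

Lemma GaE (R : realType) (B1 B2 x y z a : R) :
  Ga B1 B2 (x, y, z, a) <->
  [/\ 0 <= x <= pi, 0 <= y <= pi, B1 <= z <= B2 & 0 <= a <= pi].
Proof. by rewrite /Ga /box4 /= !in_itv/=; split=> [[[[]]]|[]]. Qed.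

Lemma D_withinB (R : realType) (lo hi t : R) (f g : R -> R) : lo < hi ->
  lo <= t <= hi -> derivable_within lo hi f t -> derivable_within lo hi g t ->
  derivable_within lo hi (fun s => f s - g s) t /\
  D_within lo hi (fun s => f s - g s) t = D_within lo hi f t - D_within lo hi g t.
Proof.
move=> lh tlh df dg; have h := quot_within_cvgB df dg.
by split; [apply: cvgP h|exact: D_withinE h].
Qed.

Lemma C1_cubeB (R : realType) (u v : R -> R -> R -> R) :
  C1_cube u -> C1_cube v ->
  C1_cube (fun x y a => u x y a - v x y a) /\
  (forall x y a, cube (x, y, a) ->
     dx3 (fun x y a => u x y a - v x y a) x y a = dx3 u x y a - dx3 v x y a /\
     dy3 (fun x y a => u x y a - v x y a) x y a = dy3 u x y a - dy3 v x y a).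
Proof.
move=> [du [cu cux cuy cua]] [dv [cv cvx cvy cva]].
have D x y a : cube (x, y, a) ->
    [/\ derivable_within 0 pi (fun t => u t y a - v t y a) x /\
        dx3 (fun x y a => u x y a - v x y a) x y a = dx3 u x y a - dx3 v x y a,
        derivable_within 0 pi (fun t => u x t a - v x t a) y /\
        dy3 (fun x y a => u x y a - v x y a) x y a = dy3 u x y a - dy3 v x y a &
        derivable_within 0 pi (fun t => u x y t - v x y t) a /\
        da3 (fun x y a => u x y a - v x y a) x y a = da3 u x y a - da3 v x y a].
  move=> c; have [u1 u2 u3] := du _ _ _ c; have [v1 v2 v3] := dv _ _ _ c.
  by have /cubeE[xp yp ap] := c; split; apply: D_withinB => //; exact: pi_gt0.
split; last by move=> x y a c; have [[_ ?] [_ ?] _] := D x y a c.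
split; first by move=> x y a c; have [[? _] [? _] [? _]] := D x y a c.
split; first exact: contB cu cv.
- apply: subspace_eq_continuous (contB cux cvx) => -[[x y] a]; rewrite inE => c.
  by have [[_ e] _ _] := D x y a c; exact: esym e.
- apply: subspace_eq_continuous (contB cuy cvy) => -[[x y] a]; rewrite inE => c.
  by have [_ [_ e] _] := D x y a c; exact: esym e.
- apply: subspace_eq_continuous (contB cua cva) => -[[x y] a]; rewrite inE => c.
  by have [_ _ [_ e]] := D x y a c; exact: esym e.
Qed.

Lemma C1_GaB (R : realType) (B1 B2 : R) (u v : R -> R -> R -> R -> R) : B1 < B2 ->
  C1_Ga B1 B2 u -> C1_Ga B1 B2 v ->
  C1_Ga B1 B2 (fun x y z a => u x y z a - v x y z a) /\
  (forall x y z a, Ga B1 B2 (x, y, z, a) ->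
     [/\ dx4 (fun x y z a => u x y z a - v x y z a) x y z a
         = dx4 u x y z a - dx4 v x y z a,
         dy4 (fun x y z a => u x y z a - v x y z a) x y z a
         = dy4 u x y z a - dy4 v x y z a &
         da4 (fun x y z a => u x y z a - v x y z a) x y z a
         = da4 u x y z a - da4 v x y z a]).
Proof.
move=> hB [du [cu cux cuy cuz cua]] [dv [cv cvx cvy cvz cva]].
set w := fun x y z a => u x y z a - v x y z a.
have D x y z a : Ga B1 B2 (x, y, z, a) ->
    [/\ derivable_within 0 pi (fun t => w t y z a) x /\
        dx4 w x y z a = dx4 u x y z a - dx4 v x y z a,
        derivable_within 0 pi (fun t => w x t z a) y /\
        dy4 w x y z a = dy4 u x y z a - dy4 v x y z a,
        derivable_within B1 B2 (fun t => w x y t a) z /\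
        dz4 B1 B2 w x y z a = dz4 B1 B2 u x y z a - dz4 B1 B2 v x y z a &
        derivable_within 0 pi (fun t => w x y z t) a /\
        da4 w x y z a = da4 u x y z a - da4 v x y z a].
  move=> c; have [u1 u2 u3 u4] := du _ _ _ _ c.
  have [v1 v2 v3 v4] := dv _ _ _ _ c; have /GaE[xp yp zp ap] := c.
  by split; apply: D_withinB => //; exact: pi_gt0.
split; last by move=> x y z a c; have [[_ ?] [_ ?] _ [_ ?]] := D x y z a c.
split; first by move=> x y z a c; have [[? _] [? _] [? _] [? _]] := D x y z a c.
split; first exact: contB cu cv.
- apply: subspace_eq_continuous (contB cux cvx) => -[[[x y] z] a]; rewrite inE => c.
  by have [[_ e] _ _ _] := D x y z a c; exact: esym e.
- apply: subspace_eq_continuous (contB cuy cvy) => -[[[x y] z] a]; rewrite inE => c.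
  by have [_ [_ e] _ _] := D x y z a c; exact: esym e.
- apply: subspace_eq_continuous (contB cuz cvz) => -[[[x y] z] a]; rewrite inE => c.
  by have [_ _ [_ e] _] := D x y z a c; exact: esym e.
- apply: subspace_eq_continuous (contB cua cva) => -[[[x y] z] a]; rewrite inE => c.
  by have [_ _ _ [_ e]] := D x y z a c; exact: esym e.
Qed.

Lemma C1norm_cube_ub (R : realType) (u : R -> R -> R -> R) (x y a : R) :
  C1_cube u -> cube (x, y, a) ->
  `|dx3 u x y a| <= C1norm_cube u /\ `|dy3 u x y a| <= C1norm_cube u.
Proof.
move=> [_ [cu cux cuy cua]] c.
have ub f : {within cube, continuous (unc3 f)} ->
    `|f x y a| <= supnorm cube (unc3 f).
  by move=> cf; apply: (supnorm_ub (@compact_box3 _ _ _ _ _ _ _) cf c).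
have := supnorm_ge0 cube (unc3 u); have := supnorm_ge0 cube (unc3 (dx3 u)).
have := supnorm_ge0 cube (unc3 (dy3 u)); have := supnorm_ge0 cube (unc3 (da3 u)).
have := ub _ cux; have := ub _ cuy; rewrite /C1norm_cube.
move: (supnorm _ _) (supnorm _ _) (supnorm _ _) (supnorm _ _) => s1 s2 s3 s4.
by move: `|_| `|_| => m1 m2; split; lra.
Qed.

Lemma C1norm_Ga_ub (R : realType) (B1 B2 : R) (u : R -> R -> R -> R -> R)
    (x y z a : R) :
  C1_Ga B1 B2 u -> Ga B1 B2 (x, y, z, a) ->
  [/\ `|u x y z a| <= C1norm_Ga B1 B2 u,
      `|dx4 u x y z a| <= C1norm_Ga B1 B2 u,
      `|dy4 u x y z a| <= C1norm_Ga B1 B2 u &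
      `|da4 u x y z a| <= C1norm_Ga B1 B2 u].
Proof.
move=> [_ [cu cux cuy cuz cua]] c.
have ub f : {within Ga B1 B2, continuous (unc4 f)} ->
    `|f x y z a| <= supnorm (Ga B1 B2) (unc4 f).
  by move=> cf; apply: (supnorm_ub (@compact_box4 _ _ _ _ _ _ _ _ _) cf c).
have := supnorm_ge0 (Ga B1 B2) (unc4 u).
have := supnorm_ge0 (Ga B1 B2) (unc4 (dx4 u)).
have := supnorm_ge0 (Ga B1 B2) (unc4 (dy4 u)).
have := supnorm_ge0 (Ga B1 B2) (unc4 (dz4 B1 B2 u)).
have := supnorm_ge0 (Ga B1 B2) (unc4 (da4 u)).
have := ub _ cu; have := ub _ cux; have := ub _ cuy; have := ub _ cua.
rewrite /C1norm_Ga.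
move: (supnorm _ _) (supnorm _ _) (supnorm _ _) (supnorm _ _) (supnorm _ _).
by move: `|_| `|_| `|_| `|_| => m1 m2 m3 m4 s1 s2 s3 s4 s5; split; lra.
Qed.

(** * The basis does not depend on the shift *)

(** If [f x > 0] then [f >= f x / 2] on a segment of positive length, which
    contributes a positive amount. *)
Lemma ge0_cont_Rintegral_eq0 (R : realType) (a b : R) (f : R -> R) :
  continuous f -> (forall t, 0 <= f t) ->
  \int[lebesgue_measure]_(t in `[a, b]) f t = 0 ->
  forall x, a < x < b -> f x = 0.
Proof.
move=> cf f0 If x /andP[ax xb]; apply/eqP; rewrite eq_le f0 andbT leNgt.
apply/negP => fx.
have fx2 : 0 < f x / 2 by rewrite divr_gt0.
have /cvgrPdist_le/(_ _ fx2)/nbhs_ballP[e /= e0 he] := cf x.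
pose k := Num.min (e / 2) (b - x).
have k0 : 0 < k by rewrite lt_min divr_gt0// subr_gt0.
have ke : k <= e / 2 by rewrite ge_min lexx.
have kb : k <= b - x by rewrite ge_min lexx orbT.
have sub : [set` `[x, x + k]] `<=` [set` `[a, b]].
  by move=> t; rewrite /= !in_itv/= => /andP[? ?]; apply/andP; split; lra.
have cff A : {within A, continuous f} by exact: continuous_subspaceT.
have h1 : f x / 2 * k <= \int[lebesgue_measure]_(t in `[x, x + k]) f t.
  have xk : x <= x + k by rewrite lerDl ltW.
  rewrite -[X in _ * X](_ : (x + k) - x = k); last by rewrite addrAC subrr add0r.
  rewrite -Rintegral_cst_seg//.
  apply: le_Rintegral => //.
  - by apply: integrable_seg; apply: continuous_subspaceT; exact: cont_cst.
  - by apply: integrable_seg; exact: cff.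
  - move=> t; rewrite /= in_itv/= => /andP[t1 t2].
    have : `|f x - f t| <= f x / 2.
      by apply: he; rewrite /ball/= distrC ger0_norm; lra.
    by rewrite ler_norml => /andP[_]; lra.
have h2 : \int[lebesgue_measure]_(t in `[x, x + k]) f t
    <= \int[lebesgue_measure]_(t in `[a, b]) f t.
  apply: fine_le.
  - by apply: integrable_fin_num => //; apply: integrable_seg; exact: cff.
  - by apply: integrable_fin_num => //; apply: integrable_seg; exact: cff.
  - apply: ge0_subset_integral => //.
    + have /integrableP[] := integrable_seg (cff `[a, b]%classic).
      by [].
    + by move=> t _; rewrite lee_fin.
have : 0 < f x / 2 * k by rewrite mulr_gt0.
by rewrite If in h2; lra.
Qed.

Definition pexp {R : realType} (P : {poly R}) : R -> R :=
  fun a => P.[a] * expR a.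

Definition pdot {R : realType} (P Q : {poly R}) : R :=
  L2dot 0 pi (pexp P) (pexp Q).

Lemma cont_pexp (R : realType) (P : {poly R}) : continuous (pexp P).
Proof. apply: contM; [exact: continuous_horner|exact: continuous_expR]. Qed.

Lemma pdotC (R : realType) (P Q : {poly R}) : pdot P Q = pdot Q P.
Proof. by rewrite /pdot /L2dot; apply: eq_Rintegral => t _; rewrite mulrC. Qed.

Lemma pdotDl (R : realType) (P Q S : {poly R}) :
  pdot (P + Q) S = pdot P S + pdot Q S.
Proof.
have i T : lebesgue_measure.-integrable `[0, pi] (EFin \o (fun t => pexp T t * pexp S t)).
  by apply: integrable_seg; apply: continuous_subspaceT;
    exact: contM (cont_pexp (P := T)) (cont_pexp (P := S)).
rewrite /pdot /L2dot -RintegralD//.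
by apply: eq_Rintegral => t _; rewrite /pexp hornerD; ring.
Qed.

Lemma pdotZl (R : realType) (c : R) (P S : {poly R}) :
  pdot (c *: P) S = c * pdot P S.
Proof.
rewrite /pdot /L2dot -RintegralZl//; last first.
  by apply: integrable_seg; apply: continuous_subspaceT;
    exact: contM (cont_pexp (P := P)) (cont_pexp (P := S)).
by apply: eq_Rintegral => t _; rewrite /pexp hornerZ; ring.
Qed.

Lemma pdot0l (R : realType) (S : {poly R}) : pdot 0 S = 0.
Proof. by rewrite -(scale0r 0) pdotZl mul0r. Qed.

Lemma pdotBl (R : realType) (P Q S : {poly R}) :
  pdot (P - Q) S = pdot P S - pdot Q S.
Proof. by rewrite pdotDl -scaleN1r pdotZl mulN1r. Qed.

Lemma pdot_suml (R : realType) (I : Type) (r : seq I) (F : I -> {poly R}) S :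
  pdot (\sum_(i <- r) F i) S = \sum_(i <- r) pdot (F i) S.
Proof.
elim: r => [|i r ih]; first by rewrite !big_nil pdot0l.
by rewrite !big_cons pdotDl ih.
Qed.

Lemma pdot_ge0 (R : realType) (P : {poly R}) : 0 <= pdot P P.
Proof. by apply: Rintegral_ge0 => t _; rewrite -expr2 sqr_ge0. Qed.

Lemma pdot_eq0 (R : realType) (P : {poly R}) : pdot P P = 0 -> P = 0.
Proof.
move=> PP; apply/eqP; apply: contraT => P0.
have n0 : 0 < (size P).+1%:R :> R by rewrite ltr0n.
(* P vanishes on the whole open segment; these are more roots than its degree. *)
pose s := mkseq (fun i => (pi : R) * (i.+1%:R / (size P).+1%:R)) (size P).
suff : (size s < size P)%N by rewrite size_mkseq ltnn.
apply: max_poly_roots P0 _ _.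
- apply/allP => y /mapP[i]; rewrite mem_iota add0n => /andP[_ iP] ->.
  set t := pi * _; rewrite /root.
  have : pexp P t * pexp P t = 0.
    apply: (@ge0_cont_Rintegral_eq0 R 0 pi (fun t => pexp P t * pexp P t)) => //.
    + exact: contM (cont_pexp (P := P)) (cont_pexp (P := P)).
    + by move=> u; rewrite -expr2 sqr_ge0.
    + rewrite /t mulr_gt0 ?pi_gt0//= ?divr_gt0 ?ltr0n//.
      by rewrite gtr_pMr ?pi_gt0// ltr_pdivrMr// mul1r ltr_nat ltnS.
  move/eqP; rewrite mulf_eq0 orbb /pexp mulf_eq0 => /orP[//|].
  by rewrite gt_eqF ?expR_gt0.
- apply/(mkseq_uniqP _) => i j _ _ /(mulfI _) h.
  have {}h := h (lt0r_neq0 (pi_gt0 R)).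
  have /(divIf (lt0r_neq0 n0))/eqP := h.
  by rewrite eqr_nat eqSS => /eqP.
Qed.

(** Gram-Schmidt orthonormalization carried out on the polynomial factors: every
    function that occurs has the form [P(a) exp a]. *)
Fixpoint gsp {R : realType} (E : nat -> {poly R}) (n : nat) : seq {poly R} :=
  if n is j.+1 then
    let s := gsp E j in
    let U := E j - \sum_(f <- s) pdot (E j) f *: f in
    rcons s ((Num.sqrt (pdot U U))^-1 *: U)
  else [::].

Lemma size_gsp (R : realType) (E : nat -> {poly R}) n : size (gsp E n) = n.
Proof. by elim: n => //= n ih; rewrite size_rcons ih. Qed.

Lemma gram_schmidt_pexp (R : realType) (E : nat -> {poly R}) n :
  gram_schmidt (L2dot 0 pi) (fun j => pexp (E j)) n = map pexp (gsp E n).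
Proof.
elim: n => //= n ih; rewrite ih map_rcons.
set U := E n - _.
have uE : (fun a => pexp (E n) a - \sum_(f <- map pexp (gsp E n))
    L2dot 0 pi (pexp (E n)) f * f a) = pexp U.
  apply/funext => a; rewrite big_map /pexp /U !hornerE horner_sum mulrBl mulr_suml.
  by congr (_ - _); apply: eq_bigr => f _; rewrite hornerZ mulrA.
rewrite uE; congr rcons; apply/funext => a.
rewrite [X in X / _](congr1 (@^~ a) uE) -/(pdot U U).
by rewrite /pexp hornerZ mulrC mulrA.
Qed.

Lemma phi_pexp (R : realType) (beta : R) n :
  phi beta n = pexp (nth 0 (gsp (fun j => ('X + beta%:P) ^+ j) n.+1) n).
Proof.
rewrite /phi -(nth_map _ (fun=> 0)) ?size_gsp// -gram_schmidt_pexp.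
suff -> : (fun j (a : R) => (a + beta) ^+ j * expR a) =
    (fun j => pexp (('X + beta%:P) ^+ j)) by [].
by apply/funext => j; apply/funext => a; rewrite /pexp horner_exp !hornerE.
Qed.

(** The Fourier projection [D |-> sum <D, f> f] onto the span of the first [n]
    vectors is the identity on polynomials of degree less than [n]. *)
Lemma gsp_proj (R : realType) (E : nat -> {poly R}) n :
  (forall j, E j \is monic) -> (forall j, size (E j) = j.+1) ->
  (forall f, f \in gsp E n -> (size f <= n)%N) /\
  (forall D : {poly R}, (size D <= n)%N ->
     \sum_(f <- gsp E n) pdot D f *: f = D).
Proof.
move=> mE sE; elim: n => [|n [ihs ihp]].
  split=> // D; rewrite leqn0 size_poly_eq0 => /eqP ->.
  by rewrite big_nil.
rewrite /=; set U := E n - _; set c := Num.sqrt _.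
have sT : (size (\sum_(f <- gsp E n) pdot (E n) f *: f)%R <= n)%N.
  rewrite big_seq; apply: (big_ind (fun p : {poly R} => (size p <= n)%N)).
  - by rewrite size_poly0.
  - move=> p q sp sq; apply: leq_trans (size_polyD _ _) _.
    by rewrite geq_max sp.
  move=> f fs; by apply: leq_trans (size_scale_leq _ _) _; exact: ihs.
have sU : size U = n.+1 by rewrite size_polyDl ?size_polyN sE// ltnS.
have lU : U`_n = 1.
  have := monicP (mE n); rewrite lead_coefE sE /= => En.
  by rewrite coefB En nth_default ?subr0.
have U0 : U != 0 by rewrite -size_poly_eq0 sU.
have c0 : 0 < pdot U U.
  rewrite lt_def pdot_ge0 andbT; apply/eqP => /pdot_eq0 h.
  by rewrite h eqxx in U0.
have cc : c^-1 * c^-1 * pdot U U = 1.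
  have -> : pdot U U = c * c by rewrite -expr2 /c sqr_sqrtr ?ltW.
  have : c != 0 by rewrite gt_eqF// sqrtr_gt0.
  by move=> ?; field.
(* U is orthogonal to all polynomials of degree less than n. *)
have orth (D : {poly R}) : (size D <= n)%N -> pdot U D = 0.
  move=> sD; rewrite pdotBl pdot_suml -[X in pdot (E n) X](ihp D sD) pdotC pdot_suml.
  apply/eqP; rewrite subr_eq0; apply/eqP; apply: eq_bigr => f _.
  by rewrite !pdotZl mulrC (pdotC D f) (pdotC f (E n)).
split.
  move=> f; rewrite mem_rcons inE => /orP[/eqP ->|/ihs]; last exact: leqW.
  by apply: leq_trans (size_scale_leq _ _) _; rewrite sU.
move=> D sD; rewrite -cats1 big_cat big_seq1 /=.
pose D' := D - D`_n *: U.
have sD' : (size D' <= n)%N.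
  apply/leq_sizeP => j; rewrite leq_eqVlt => /predU1P[<-|nj].
    by rewrite coefB coefZ lU mulr1 subrr.
  rewrite coefB coefZ (nth_default 0 (leq_trans sD nj)).
  by rewrite [U`_j]nth_default ?mulr0 ?subr0 ?sU.
have DE : D = D' + D`_n *: U by rewrite subrK.
have h1 : \sum_(f <- gsp E n) pdot D f *: f = D'.
  rewrite -[RHS](ihp D' sD') [LHS]big_seq [RHS]big_seq; apply: eq_bigr => f fs.
  by rewrite {1}DE pdotDl pdotZl (orth f (ihs f fs)) mulr0 addr0.
have h2 : pdot D U = D`_n * pdot U U.
  by rewrite {1}DE pdotDl pdotZl (pdotC D') (orth D' sD') add0r.
rewrite h1 [in RHS]DE; congr (_ + _).
rewrite pdotC pdotZl pdotC h2 scalerA; congr (_ *: _).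
by rewrite -[RHS]mulr1 -cc; ring.
Qed.

(** Two monic polynomials of degree [n] differ by one of lower degree, which lies
    in the span of the vectors already constructed; so they have the same component
    orthogonal to that span. *)
Lemma gsp_unique (R : realType) (E E' : nat -> {poly R}) n :
  (forall j, E j \is monic) -> (forall j, size (E j) = j.+1) ->
  (forall j, E' j \is monic) -> (forall j, size (E' j) = j.+1) ->
  gsp E n = gsp E' n.
Proof.
move=> mE sE mE' sE'; elim: n => //= n <-.
have [_ proj] := gsp_proj n mE sE.
suff -> : E n - \sum_(f <- gsp E n) pdot (E n) f *: f =
          E' n - \sum_(f <- gsp E n) pdot (E' n) f *: f by [].
have sD : (size (E n - E' n)%R <= n)%N.
  apply/leq_sizeP => j; rewrite leq_eqVlt => /predU1P[<-|nj].
    have := monicP (mE n); have := monicP (mE' n).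
    by rewrite !lead_coefE sE sE' /= coefB => -> ->; rewrite subrr.
  by rewrite coefB !nth_default ?subrr ?sE ?sE'.
have : \sum_(f <- gsp E n) pdot (E n) f *: f -
    \sum_(f <- gsp E n) pdot (E' n) f *: f = E n - E' n.
  rewrite -[RHS](proj _ sD) -sumrB; apply: eq_bigr => f _.
  by rewrite pdotBl scalerBl.
move: (\sum_(f <- _) _) (\sum_(f <- _) _) => S S' SE.
by rewrite -[E n](subrK (E' n)) -SE; ring.
Qed.

(** The factors [(a + beta)^n] are monic of degree [n] in [a] whatever [beta] is. *)
Lemma phi_shift (R : realType) (beta beta' : R) : phi beta = phi beta'.
Proof.
apply/funext => n; rewrite !phi_pexp.
have mX (b : R) j : ('X + b%:P) ^+ j \is monic.
  by apply: monic_exp; rewrite -[b]opprK polyCN monicXsubC.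
have sX (b : R) j : size (('X + b%:P) ^+ j) = j.+1.
  by rewrite -[b]opprK polyCN size_exp_XsubC.
by rewrite (gsp_unique n.+1 (mX beta) (sX beta) (mX beta') (sX beta')).
Qed.

Lemma cont_phi (R : realType) (beta : R) n : continuous (phi beta n).
Proof. by rewrite phi_pexp; exact: cont_pexp. Qed.

Lemma cont_derive1_phi (R : realType) (beta : R) n :
  continuous (derive1 (phi beta n)).
Proof.
rewrite phi_pexp; set P := nth _ _ _.
rewrite (_ : derive1 _ = pexp (P^`() + P)); first exact: cont_pexp.
apply/funext => a; rewrite derive1E.
have dP : is_derive a (1 : R) (pexp P) (P.[a] *: expR a + expR a *: P^`().[a]).
  exact: is_deriveM.
by rewrite derive_val /pexp hornerD /GRing.scale/=; ring.
Qed.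

(** * Estimates for [Lambda] *)

Definition square {R : realType} : set (R * R) := `[0, pi] `*` `[0, pi].

Lemma within_section2 (R : realType) (f : R -> R -> R) y :
  {within square, continuous (fun X : R * R => f X.1 X.2)} -> 0 <= y <= pi ->
  {within `[0, pi], continuous (f ^~ y)}.
Proof.
move=> cf yp.
have c : {within `[0, pi], continuous (fun x : R => (x, y))}.
  by apply: continuous_subspaceT; exact: cont_pair (@cont_id R) (cont_cst (c := y)).
by apply: (within_comp cf c) => x xp; split; rewrite //= in_itv.
Qed.

Lemma within_section3 (R : realType) (h : R -> R -> R -> R) x y :
  {within cube, continuous (unc3 h)} -> 0 <= x <= pi -> 0 <= y <= pi ->
  {within `[0, pi], continuous (h x y)}.
Proof.
move=> ch xp yp.
have c : {within `[0, pi], continuous (fun a : R => (x, y, a))}.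
  by apply: continuous_subspaceT; exact: cont_pair (cont_cst (c := (x, y))) (@cont_id R).
by apply: (within_comp ch c) => a; rewrite /= in_itv/= => ap; apply/cubeE.
Qed.

Lemma within_square_at (R : realType) (h : R -> R -> R -> R) a :
  {within cube, continuous (unc3 h)} -> 0 <= a <= pi ->
  {within square, continuous (fun X : R * R => h X.1 X.2 a)}.
Proof.
move=> ch ap.
have c : {within square, continuous (fun X : R * R => (X.1, X.2, a))}.
  apply: continuous_subspaceT; apply: cont_pair (cont_cst (c := a)).
  exact: cont_pair (cont_fst (@cont_id _)) (cont_snd (@cont_id _)).
apply: (within_comp ch c) => -[x y]; rewrite /square /= !in_itv/= => -[xp yp].
by apply/cubeE.
Qed.

Lemma within_Rintegral_cube (R : realType) (h : R -> R -> R -> R) (g : R -> R) :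
  {within cube, continuous (unc3 h)} -> continuous g ->
  {within square, continuous (fun X : R * R =>
     \int[lebesgue_measure]_(a in `[0, pi]) (h X.1 X.2 a * g a))}.
Proof.
move=> ch cg; apply: within_Rintegral_param; first exact: pi_ge0.
apply: contM; last by apply: continuous_subspaceT; exact: cont_comp cg (cont_snd (@cont_id _)).
exact: ch.
Qed.

Lemma Rintegral2_dist_le (R : realType) (f g : R -> R -> R) (e : R) :
  {within square, continuous (fun X : R * R => f X.1 X.2)} ->
  {within square, continuous (fun X : R * R => g X.1 X.2)} ->
  (forall x y, 0 <= x <= pi -> 0 <= y <= pi -> `|f x y - g x y| <= e) ->
  `| \int[lebesgue_measure]_(y in `[0, pi]) \int[lebesgue_measure]_(x in `[0, pi]) f x y
   - \int[lebesgue_measure]_(y in `[0, pi]) \int[lebesgue_measure]_(x in `[0, pi]) g x y |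
  <= e * pi * pi.
Proof.
move=> cf cg fge; have p0 := pi_ge0 R.
have cI (h : R -> R -> R) : {within square, continuous (fun X : R * R => h X.1 X.2)} ->
    {within `[0, pi], continuous
      (fun y => \int[lebesgue_measure]_(x in `[0, pi]) h x y)}.
  move=> ch; apply: (within_Rintegral_param (F := fun y x => h x y)) => //.
  have c : {within (`[0, pi] `*` `[0, pi])%classic,
      continuous (fun X : R * R => (X.2, X.1))}.
    apply: continuous_subspaceT.
    exact: cont_pair (cont_snd (@cont_id _)) (cont_fst (@cont_id _)).
  by apply: (within_comp ch c) => -[x y] [? ?]; split.
rewrite -[X in _ * X](subr0 pi); apply: Rintegral_dist_le_cst => //; try exact: cI.
move=> y yp; rewrite -[X in _ * X](subr0 pi); apply: Rintegral_dist_le_cst => //.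
- exact: within_section2.
- exact: within_section2.
- by move=> x xp; exact: fge.
Qed.

(** The part of [Lambda] that follows the inner integral, as a function of the
    values [G l x y] of that integral. *)
Definition solve_system {R : realType} (N K : nat) (beta : R)
    (G : nat -> R -> R -> R) (n : 'I_N) (k m : 'I_K) : R :=
  (invmx (Lambda_mx N beta) *m
   \col_(l < N)
     - (\int[lebesgue_measure]_(y in `[0, pi])
          (\int[lebesgue_measure]_(x in `[0, pi])
             (G l x y * sin (k.+1%:R * x) * sin (m.+1%:R * y)))))
  n 0.

Lemma solve_system_dist_le (R : realType) (N K : nat) (beta M e : R)
    (G H : nat -> R -> R -> R) (n : 'I_N) (k m : 'I_K) :
  (forall i j, `|invmx (Lambda_mx N beta) i j| <= M) ->
  (forall l, {within square, continuous (fun X : R * R => G l X.1 X.2)}) ->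
  (forall l, {within square, continuous (fun X : R * R => H l X.1 X.2)}) ->
  (forall (l : 'I_N) x y, 0 <= x <= pi -> 0 <= y <= pi ->
     `|G l x y - H l x y| <= e) ->
  `|solve_system beta G n k m - solve_system beta H n k m|
  <= N%:R * (M * (e * pi * pi)).
Proof.
move=> hM cG cH GH.
have M0 : 0 <= M by apply: le_trans (hM n n).
have sE (F : nat -> R -> R -> R) : solve_system beta F n k m =
    \sum_(l < N) invmx (Lambda_mx N beta) n l *
      - (\int[lebesgue_measure]_(y in `[0, pi])
          (\int[lebesgue_measure]_(x in `[0, pi])
             (F l x y * sin (k.+1%:R * x) * sin (m.+1%:R * y)))).
  by rewrite /solve_system mxE; apply: eq_bigr => l _; rewrite [X in _ * X]mxE.
rewrite !sE -sumrB.
apply: le_trans (ler_norm_sum _ _ _) _.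
rewrite -[X in X%:R * _](card_ord N) mulr_natl -sumr_const.
apply: ler_sum => l _; rewrite -mulrBr normrM.
apply: ler_pM => //; rewrite -opprD normrN.
have cs (F : nat -> R -> R -> R) :
    (forall l, {within square, continuous (fun X : R * R => F l X.1 X.2)}) ->
    {within square, continuous (fun X : R * R =>
      F l X.1 X.2 * sin (k.+1%:R * X.1) * sin (m.+1%:R * X.2))}.
  move=> cF; apply: contM; first apply: contM; first exact: cF.
  - apply: continuous_subspaceT; apply: (cont_comp (@continuous_sin R)).
    by apply: contM; [exact: cont_cst|exact: cont_fst (@cont_id _)].
  - apply: continuous_subspaceT; apply: (cont_comp (@continuous_sin R)).
    by apply: contM; [exact: cont_cst|exact: cont_snd (@cont_id _)].
apply: (Rintegral2_dist_le (cs _ cG) (cs _ cH)) => x y xp yp.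
rewrite -!mulrBl 2!normrM.
have s1 (t : R) : `|sin t| <= 1 by rewrite ler_norml sin_geN1 sin_le1.
rewrite -[e]mulr1 -[e * 1]mulr1.
by rewrite ler_pM ?mulr_ge0// ler_pM// GH.
Qed.

Lemma inner_C0_cont (R : realType) (beta : R) l (h : R -> R -> R -> R) :
  {within cube, continuous (unc3 h)} ->
  {within square, continuous (fun X : R * R => inner_C0 beta l (h X.1 X.2))}.
Proof.
move=> ch; have p0 := pi_ge0 R; apply: contB; last first.
  by apply: within_Rintegral_cube ch _; exact: cont_derive1_phi.
have c0 a : 0 <= a <= pi ->
    {within square, continuous (fun X : R * R => h X.1 X.2 a * phi beta l a)}.
  by move=> ap; apply: contM; [exact: within_square_at|exact: cont_cst].
by apply: contB; apply: c0; rewrite lexx ?p0.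
Qed.

Lemma inner_C1_cont (R : realType) (beta : R) l (h : R -> R -> R -> R) :
  {within cube, continuous (unc3 (da3 h))} ->
  {within square, continuous (fun X : R * R => inner_C1 beta l (h X.1 X.2))}.
Proof. by move=> ch; apply: within_Rintegral_cube ch _; exact: cont_phi. Qed.

Lemma dist_mulr_le (R : realType) (u v w e P : R) :
  `|u - v| <= e -> `|w| <= P -> `|u * w - v * w| <= e * P.
Proof. by move=> uv wP; rewrite -mulrBl normrM ler_pM. Qed.

(** Integration by parts leaves no derivative of [f - g], so that a bound of [f - g]
    itself suffices. *)
Lemma inner_C0_dist_le (R : realType) (beta e P : R) l (f g : R -> R) :
  {within `[0, pi], continuous f} -> {within `[0, pi], continuous g} ->
  (forall a, 0 <= a <= pi -> `|f a - g a| <= e) ->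
  (forall a, 0 <= a <= pi -> `|phi beta l a| <= P) ->
  (forall a, 0 <= a <= pi -> `|derive1 (phi beta l) a| <= P) ->
  `|inner_C0 beta l f - inner_C0 beta l g| <= e * P * (2 + pi).
Proof.
move=> cf cg fge hP hP'; have p0 := pi_ge0 R.
have h1 : `|f pi * phi beta l pi - g pi * phi beta l pi| <= e * P.
  by apply: dist_mulr_le; [apply: fge|apply: hP]; rewrite lexx p0.
have h2 : `|f 0 * phi beta l 0 - g 0 * phi beta l 0| <= e * P.
  by apply: dist_mulr_le; [apply: fge|apply: hP]; rewrite lexx p0.
have cd : {within `[0, pi], continuous (derive1 (phi beta l))}.
  by apply: continuous_subspaceT; exact: cont_derive1_phi.
have h3 := Rintegral_dist_le_cst p0 (contM cf cd) (contM cg cd) (e := e * P)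
  (fun a ap => dist_mulr_le (fge a ap) (hP' a ap)).
rewrite subr0 in h3; rewrite /inner_C0.
move: h1 h2 h3; rewrite !ler_norml => /andP[? ?] /andP[? ?] /andP[? ?].
by apply/andP; split; lra.
Qed.

Lemma inner_C1_dist_le (R : realType) (beta e P : R) l (f g : R -> R) :
  {within `[0, pi], continuous (D_within 0 pi f)} ->
  {within `[0, pi], continuous (D_within 0 pi g)} ->
  (forall a, 0 <= a <= pi -> `|D_within 0 pi f a - D_within 0 pi g a| <= e) ->
  (forall a, 0 <= a <= pi -> `|phi beta l a| <= P) ->
  `|inner_C1 beta l f - inner_C1 beta l g| <= e * P * pi.
Proof.
move=> cf cg fge hP; have p0 := pi_ge0 R.
have cp : {within `[0, pi], continuous (phi beta l)}.
  by apply: continuous_subspaceT; exact: cont_phi.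
have h3 := Rintegral_dist_le_cst p0 (contM cf cp) (contM cg cp) (e := e * P)
  (fun a ap => dist_mulr_le (fge a ap) (hP a ap)).
by rewrite subr0 in h3.
Qed.

(** [P] bounds the basis and its derivatives on [[0, pi]], [M] the entries of the
    inverse matrix.  In the factor [2 + pi] the 2 accounts for the boundary terms of
    the integration by parts; the same constant serves both readings of the inner
    integral. *)
Definition Lambda_const {R : realType} (N : nat) (M P : R) : R :=
  N%:R * (M * (P * (2 + pi) * pi * pi)).

Lemma Lambda_C0_dist_le (R : realType) (N K : nat) (beta M P e : R)
    (f g : R -> R -> R -> R) (n : 'I_N) (k m : 'I_K) :
  (forall i j, `|invmx (Lambda_mx N beta) i j| <= M) ->
  (forall (l : 'I_N) a, 0 <= a <= pi ->
     `|phi beta l a| <= P /\ `|derive1 (phi beta l) a| <= P) ->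
  {within cube, continuous (unc3 f)} -> {within cube, continuous (unc3 g)} ->
  (forall x y a, cube (x, y, a) -> `|f x y a - g x y a| <= e) ->
  `|Lambda beta inner_C0 f n k m - Lambda beta inner_C0 g n k m|
  <= Lambda_const N M P * e.
Proof.
move=> hM hP cf cg fge.
have -> : Lambda_const N M P * e = N%:R * (M * ((e * P * (2 + pi)) * pi * pi)).
  by rewrite /Lambda_const; ring.
apply: (@solve_system_dist_le R N K beta M _ (fun l x y => inner_C0 beta l (f x y))
  (fun l x y => inner_C0 beta l (g x y))) => //.
- by move=> l; exact: inner_C0_cont.
- by move=> l; exact: inner_C0_cont.
- move=> l x y xp yp; apply: inner_C0_dist_le.
  + exact: within_section3.
  + exact: within_section3.
  + by move=> a ap; apply: fge; apply/cubeE.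
  + by move=> a /(hP l)[].
  + by move=> a /(hP l)[].
Qed.

Lemma Lambda_C1_dist_le (R : realType) (N K : nat) (beta M P e : R)
    (f g : R -> R -> R -> R) (n : 'I_N) (k m : 'I_K) :
  (forall i j, `|invmx (Lambda_mx N beta) i j| <= M) ->
  (forall (l : 'I_N) a, 0 <= a <= pi ->
     `|phi beta l a| <= P /\ `|derive1 (phi beta l) a| <= P) ->
  {within cube, continuous (unc3 (da3 f))} ->
  {within cube, continuous (unc3 (da3 g))} ->
  (forall x y a, cube (x, y, a) -> `|da3 f x y a - da3 g x y a| <= e) ->
  `|Lambda beta inner_C1 f n k m - Lambda beta inner_C1 g n k m|
  <= Lambda_const N M P * e.
Proof.
move=> hM hP cf cg fge.
have p0 := pi_ge0 R; have M0 : 0 <= M by apply: le_trans (hM n n).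
have zp : 0 <= (0 : R) <= pi by rewrite lexx p0.
have P0 : 0 <= P by have [+ _] := hP n 0 zp; apply: le_trans.
have e0 : 0 <= e by apply: le_trans (fge 0 0 0 _) => //; apply/cubeE.
have le1 : N%:R * (M * ((e * P * pi) * pi * pi)) <= Lambda_const N M P * e.
  have -> : Lambda_const N M P * e = N%:R * (M * ((e * P * (2 + pi)) * pi * pi)).
    by rewrite /Lambda_const; ring.
  rewrite ler_wpM2l// ler_wpM2l// ler_wpM2r// ler_wpM2r// ler_wpM2l ?mulr_ge0//.
  by rewrite lerDr.
apply: le_trans le1.
apply: (@solve_system_dist_le R N K beta M _ (fun l x y => inner_C1 beta l (f x y))
  (fun l x y => inner_C1 beta l (g x y))) => //.
- by move=> l; exact: inner_C1_cont.
- by move=> l; exact: inner_C1_cont.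
- move=> l x y xp yp; apply: inner_C1_dist_le.
  + exact: (within_section3 cf).
  + exact: (within_section3 cg).
  + by move=> a ap; apply: fge; apply/cubeE.
  + by move=> a /(hP l)[].
Qed.

(** * The function [v] and its derivatives *)

(** The derivative of [t |-> k / ((t - b)^2 + c)]; both partial derivatives of [v0]
    have this form. *)
Definition lorentz_deriv {R : realType} (k b c t : R) : R :=
  - (k * (2 * (t - b)) / ((t - b) ^+ 2 + c) ^+ 2).

Lemma is_derive_lorentz (R : realType) (k b c t : R) : 0 < c ->
  is_derive t (1 : R) (fun s => k / ((s - b) ^+ 2 + c)) (lorentz_deriv k b c t).
Proof.
move=> c0; have n0 : (t - b) ^+ 2 + c != 0.
  by rewrite gt_eqF// ltr_wpDl// sqr_ge0.
have dg : is_derive t (1 : R) (fun s => (s - b) ^+ 2 + c) (2 * (t - b)).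
  by apply: is_derive_eq; rewrite /GRing.scale/=; ring.
have dV := @is_deriveV R (fun s => (s - b) ^+ 2 + c) t _ 1 n0 dg.
have dk := is_deriveM (is_derive_cst k t (1 : R)) dV.
have e : cst k t *: (- ((t - b) ^+ 2 + c) ^- 2 *: (2 * (t - b))) +
    ((t - b) ^+ 2 + c)^-1 *: 0 = lorentz_deriv k b c t.
  by rewrite /lorentz_deriv /GRing.scale/=; field.
by rewrite e in dk.
Qed.

Lemma cont_lorentz_den (R : realType) (T : topologicalType) (f g : T -> R) (c : R) :
  0 < c -> continuous f -> continuous g ->
  continuous (fun X => (f X ^+ 2 + g X ^+ 2 + c)^-1).
Proof.
move=> c0 cf cg; apply: contV.
  by apply: contD; [apply: contD; exact: contX|exact: cont_cst].
by move=> X; rewrite gt_eqF// ltr_wpDl// addr_ge0// sqr_ge0.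
Qed.

Lemma lorentz_deriv_le (R : realType) (k b c t r : R) : 0 < k -> k <= c ->
  `|t - b| <= r -> `|lorentz_deriv k b c t| <= k * (2 * r) / k ^+ 2.
Proof.
move=> k0 kc tb; rewrite /lorentz_deriv normrN !normrM normfV.
have h : k <= (t - b) ^+ 2 + c by rewrite ler_wpDl// sqr_ge0.
rewrite (ger0_norm (ltW k0)) (ger0_norm (ler0n _ 2)) (ger0_norm (sqr_ge0 _)).
apply: ler_pM => //.
- by rewrite !mulr_ge0// ltW.
- by rewrite invr_ge0 sqr_ge0.
- by rewrite ler_pM2l// ler_pM2l.
- rewrite lef_pV2 ?posrE ?exprn_gt0//; last exact: lt_le_trans h.
  by rewrite ler_pXn2r ?nnegrE// ?ltW// (lt_le_trans _ h).
Qed.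

Definition v0_dx {R : realType} (B1 x y a : R) : R :=
  lorentz_deriv (B1 ^+ 2) a ((y - pi / 2) ^+ 2 + B1 ^+ 2) x.
Definition v0_dy {R : realType} (B1 x y a : R) : R :=
  lorentz_deriv (B1 ^+ 2) (pi / 2) ((x - a) ^+ 2 + B1 ^+ 2) y.

Lemma quot_within_v0x (R : realType) (B1 x y a : R) : 0 < B1 ->
  quot_within 0 pi (fun t => v0 B1 t y a) x --> v0_dx B1 x y a.
Proof.
move=> B0; apply: quot_within_is_derive.
have c0 : 0 < (y - pi / 2) ^+ 2 + B1 ^+ 2.
  by rewrite ltr_wpDl ?sqr_ge0// exprn_gt0.
rewrite (_ : (fun t => _) =
    (fun t => B1 ^+ 2 / ((t - a) ^+ 2 + ((y - pi / 2) ^+ 2 + B1 ^+ 2)))).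
  exact: is_derive_lorentz.
by apply/funext => t; rewrite /v0 addrA.
Qed.

Lemma quot_within_v0y (R : realType) (B1 x y a : R) : 0 < B1 ->
  quot_within 0 pi (fun t => v0 B1 x t a) y --> v0_dy B1 x y a.
Proof.
move=> B0; apply: quot_within_is_derive.
have c0 : 0 < (x - a) ^+ 2 + B1 ^+ 2.
  by rewrite ltr_wpDl ?sqr_ge0// exprn_gt0.
rewrite (_ : (fun t => _) =
    (fun t => B1 ^+ 2 / ((t - pi / 2) ^+ 2 + ((x - a) ^+ 2 + B1 ^+ 2)))).
  exact: is_derive_lorentz.
by apply/funext => t; rewrite /v0 addrCA addrA.
Qed.

Definition v0_deriv_bound {R : realType} (B1 : R) : R :=
  B1 ^+ 2 * (2 * pi) / (B1 ^+ 2) ^+ 2.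

Lemma v0_deriv_le (R : realType) (B1 x y a : R) : 0 < B1 ->
  0 <= x <= pi -> 0 <= y <= pi -> 0 <= a <= pi ->
  `|v0_dx B1 x y a| <= v0_deriv_bound B1 /\
  `|v0_dy B1 x y a| <= v0_deriv_bound B1.
Proof.
move=> B0 /andP[x0 xp] /andP[y0 yp] /andP[a0 ap].
have p0 := pi_gt0 R.
split; apply: lorentz_deriv_le.
- by rewrite exprn_gt0.
- by rewrite lerDr sqr_ge0.
- by rewrite ler_norml; apply/andP; split; lra.
- by rewrite exprn_gt0.
- by rewrite lerDr sqr_ge0.
- by rewrite ler_norml; apply/andP; split; lra.
Qed.

Lemma v0_ge (R : realType) (B1 x y a : R) : 0 < B1 ->
  0 <= x <= pi -> 0 <= y <= pi -> 0 <= a <= pi ->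
  B1 ^+ 2 / (B1 ^+ 2 + 5 * pi ^+ 2 / 4) <= v0 B1 x y a.
Proof.
move=> B0 /andP[x0 xp] /andP[y0 yp] /andP[a0 ap].
have p0 := pi_gt0 R; have b0 : 0 < B1 ^+ 2 by rewrite exprn_gt0.
have sqr_le_norm (u r : R) : 0 <= r -> `|u| <= r -> u ^+ 2 <= r ^+ 2.
  by move=> r0 ur; rewrite -real_normK ?num_real// ler_pXn2r ?nnegrE.
have h1 : (x - a) ^+ 2 <= pi ^+ 2.
  by apply: sqr_le_norm; [exact: ltW|rewrite ler_norml; apply/andP; split; lra].
have h2 : (y - pi / 2) ^+ 2 <= (pi / 2) ^+ 2.
  by apply: sqr_le_norm; [lra|rewrite ler_norml; apply/andP; split; lra].
rewrite /v0 ler_pM2l// lef_pV2 ?posrE.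
- have : (pi / 2) ^+ 2 = pi ^+ 2 / 4 :> R by field.
  by move: (pi ^+ 2) (B1 ^+ 2) h1 h2 => p b; lra.
- by rewrite ltr_wpDr// divr_ge0// mulr_ge0// sqr_ge0.
- by rewrite ltr_wpDl// addr_ge0// sqr_ge0.
Qed.

Lemma cont_v0 (R : realType) (B1 : R) : 0 < B1 ->
  [/\ continuous (unc4 (fun x y z a => v0 B1 x y a)),
      continuous (unc4 (fun x y z a => v0_dx B1 x y a)) &
      continuous (unc4 (fun x y z a => v0_dy B1 x y a))].
Proof.
move=> B0; have b0 : 0 < B1 ^+ 2 by rewrite exprn_gt0.
pose T : topologicalType := (R * R * R * R)%type.
have cx : continuous (fun X : T => X.1.1.1).
  exact: cont_fst (cont_fst (cont_fst (@cont_id _))).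
have cy : continuous (fun X : T => X.1.1.2).
  exact: cont_snd (cont_fst (cont_fst (@cont_id _))).
have ca : continuous (fun X : T => X.2) by exact: cont_snd (@cont_id _).
have f : continuous (fun X : T => X.1.1.1 - X.2) by exact: contB cx ca.
have g : continuous (fun X : T => X.1.1.2 - pi / 2).
  exact: contB cy (cont_cst (c := pi / 2)).
have den := cont_lorentz_den b0 f g.
split.
- by apply: contM den; exact: cont_cst.
- rewrite (_ : unc4 _ = fun X : T => - (B1 ^+ 2 * (2 * (X.1.1.1 - X.2)) *
      (((X.1.1.1 - X.2) ^+ 2 + (X.1.1.2 - pi / 2) ^+ 2 + B1 ^+ 2)^-1) ^+ 2)).
    apply: contN; apply: contM (contX den).
    by apply: contM; [exact: cont_cst|apply: contM => //; exact: cont_cst].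
  by apply/funext => X; rewrite /unc4 /v0_dx /lorentz_deriv addrA exprVn.
- rewrite (_ : unc4 _ = fun X : T => - (B1 ^+ 2 * (2 * (X.1.1.2 - pi / 2)) *
      (((X.1.1.1 - X.2) ^+ 2 + (X.1.1.2 - pi / 2) ^+ 2 + B1 ^+ 2)^-1) ^+ 2)).
    apply: contN; apply: contM (contX den).
    by apply: contM; [exact: cont_cst|apply: contM => //; exact: cont_cst].
  by apply/funext => X; rewrite /unc4 /v0_dy /lorentz_deriv addrCA addrA exprVn.
Qed.

(** With [f], [g] chosen among [sine] and [dsine] this is [V_Q] or one of its
    derivatives in [x] and [y]. *)
Definition Vfg {R : realType} (N K : nat) (beta : R) (f g : nat -> R -> R)
    (Q : R -> 'I_N -> 'I_K -> 'I_K -> R) (x y z a : R) : R :=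
  \sum_(n < N) \sum_(k < K) \sum_(m < K)
    Q z n k m * phi beta n a * f k x * g m y.

Definition sine {R : realType} (k : nat) (t : R) : R := sin (k.+1%:R * t).
Definition dsine {R : realType} (k : nat) (t : R) : R :=
  k.+1%:R * cos (k.+1%:R * t).

Definition norm1 {R : realType} (N K : nat) (w : 'I_N -> 'I_K -> 'I_K -> R) : R :=
  \sum_(n < N) \sum_(k < K) \sum_(m < K) `|w n k m|.

Lemma norm1_ge0 (R : realType) (N K : nat) (w : 'I_N -> 'I_K -> 'I_K -> R) :
  0 <= norm1 w.
Proof. by do 3![apply: sumr_ge0 => ? _]. Qed.

Lemma norm1_ub (R : realType) (N K : nat) (w : 'I_N -> 'I_K -> 'I_K -> R) n k m :
  `|w n k m| <= norm1 w.
Proof.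
rewrite /norm1 (bigD1 n)//= (bigD1 k)//= (bigD1 m)//= -!addrA lerDl.
by rewrite !addr_ge0//; do ?[apply: sumr_ge0 => ? _].
Qed.

Lemma norm1_le (R : realType) (N K : nat) (w : 'I_N -> 'I_K -> 'I_K -> R) (c : R) :
  (forall n k m, `|w n k m| <= c) -> norm1 w <= (N * K * K)%:R * c.
Proof.
move=> h; apply: (@le_trans _ _ (\sum_(n < N) \sum_(k < K) \sum_(m < K) c)).
  by do 3![apply: ler_sum => ? _].
by rewrite !sumr_const !card_ord -!mulrnA mulr_natl (mulnC K N) (mulnC K).
Qed.

Lemma Vfg_le (R : realType) (N K : nat) (beta P : R) (f g : nat -> R -> R)
    (Q : R -> 'I_N -> 'I_K -> 'I_K -> R) (x y z a : R) :
  (forall n : 'I_N, `|phi beta n a| <= P) ->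
  (forall k m : 'I_K, `|f k x * g m y| <= K%:R) ->
  `|Vfg beta f g Q x y z a| <= P * K%:R * norm1 (Q z).
Proof.
move=> hP hfg; rewrite /norm1 mulr_sumr.
apply: le_trans (ler_norm_sum _ _ _) _; apply: ler_sum => n _.
rewrite mulr_sumr; apply: le_trans (ler_norm_sum _ _ _) _; apply: ler_sum => k _.
rewrite mulr_sumr; apply: le_trans (ler_norm_sum _ _ _) _; apply: ler_sum => m _.
rewrite (_ : _ * _ * f k x * g m y = phi beta n a * (f k x * g m y) * Q z n k m);
  last by ring.
by rewrite 2!normrM ler_wpM2r// ler_pM.
Qed.

Lemma VfgB (R : realType) (N K : nat) (beta : R) (f g : nat -> R -> R)
    (Q1 Q2 : R -> 'I_N -> 'I_K -> 'I_K -> R) (x y z a : R) :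
  Vfg beta f g Q1 x y z a - Vfg beta f g Q2 x y z a
  = Vfg beta f g (fun z n k m => Q1 z n k m - Q2 z n k m) x y z a.
Proof.
rewrite /Vfg -sumrB; apply: eq_bigr => n _; rewrite -sumrB.
apply: eq_bigr => k _; rewrite -sumrB; apply: eq_bigr => m _.
by rewrite !mulrBl.
Qed.

Lemma within_Vfg (R : realType) (N K : nat) (B1 B2 beta : R) (f g : nat -> R -> R)
    (Q : R -> 'I_N -> 'I_K -> 'I_K -> R) :
  (forall k, continuous (f k)) -> (forall k, continuous (g k)) ->
  (forall n k m, {within `[B1, B2], continuous (fun z => Q z n k m)}) ->
  {within Ga B1 B2, continuous (unc4 (Vfg beta f g Q))}.
Proof.
move=> cf cg cQ; do 3![apply: cont_sum => ?].
apply: contM; first apply: contM; first apply: contM.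
- apply: (within_comp (cQ _ _ _)).
    apply: continuous_subspaceT.
    exact: cont_snd (cont_fst (@cont_id _)).
  by move=> [[[x y] z] a] /GaE[_ _ zB _]; rewrite /= in_itv.
- apply: continuous_subspaceT; apply: (cont_comp (cont_phi (n := _))).
  exact: cont_snd (@cont_id _).
- apply: continuous_subspaceT; apply: (cont_comp (cf _)).
  exact: cont_fst (cont_fst (cont_fst (@cont_id _))).
- apply: continuous_subspaceT; apply: (cont_comp (cg _)).
  exact: cont_snd (cont_fst (cont_fst (@cont_id _))).
Qed.

Lemma cont_sine (R : realType) k : continuous (@sine R k).
Proof.
apply: (cont_comp (@continuous_sin R)).
by apply: contM; [exact: cont_cst|exact: cont_id].
Qed.

Lemma cont_dsine (R : realType) k : continuous (@dsine R k).
Proof.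
apply: contM; first exact: cont_cst.
apply: (cont_comp (@continuous_cos R)).
by apply: contM; [exact: cont_cst|exact: cont_id].
Qed.

Lemma sine_le (R : realType) (k : nat) (t : R) : `|sine k t| <= 1.
Proof. by rewrite ler_norml sin_geN1 sin_le1. Qed.

Lemma dsine_le (R : realType) (K : nat) (k : 'I_K) (t : R) : `|dsine k t| <= K%:R.
Proof.
rewrite /dsine normrM ger0_norm// -[leRHS]mulr1.
by apply: ler_pM => //; [rewrite ler_nat|rewrite ler_norml cos_geN1 cos_le1].
Qed.

Lemma sine_sine_le (R : realType) (K : nat) (k m : 'I_K) (x y : R) :
  `|sine k x * sine m y| <= K%:R.
Proof.
rewrite normrM -[leRHS]mulr1 ler_pM ?sine_le//.
apply: le_trans (sine_le _ _) _; rewrite ler1n.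
by case: K k {m} => // -[].
Qed.

Lemma dsine_sine_le (R : realType) (K : nat) (k m : 'I_K) (x y : R) :
  `|dsine k x * sine m y| <= K%:R.
Proof. by rewrite normrM -[leRHS]mulr1 ler_pM ?sine_le// dsine_le. Qed.

Lemma sine_dsine_le (R : realType) (K : nat) (k m : 'I_K) (x y : R) :
  `|sine k x * dsine m y| <= K%:R.
Proof. by rewrite mulrC dsine_sine_le. Qed.

Lemma quot_within_sine (R : realType) (lo hi : R) (k : nat) (t : R) :
  quot_within lo hi (sine k) t --> dsine k t.
Proof.
apply: quot_within_is_derive; rewrite /sine /dsine; apply: is_derive_eq.
by rewrite /GRing.scale/=; ring.
Qed.

Lemma quot_within_VQx (R : realType) (N K : nat) (beta : R)
    (Q : R -> 'I_N -> 'I_K -> 'I_K -> R) (x y z a : R) :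
  quot_within 0 pi (fun t => VQ beta Q t y z a) x -->
  Vfg beta dsine sine Q x y z a.
Proof.
apply: quot_within_cvg_sum => n; apply: quot_within_cvg_sum => k.
apply: quot_within_cvg_sum => m.
rewrite (_ : (fun s => _) =
    fun s => (Q z n k m * phi beta n a * sine m y) * sine k s); last first.
  by apply/funext => s; rewrite mulrAC.
have -> : Q z n k m * phi beta n a * dsine k x * sine m y =
    Q z n k m * phi beta n a * sine m y * dsine k x by exact: mulrAC.
by apply: quot_within_cvgZ; exact: quot_within_sine.
Qed.

Lemma quot_within_VQy (R : realType) (N K : nat) (beta : R)
    (Q : R -> 'I_N -> 'I_K -> 'I_K -> R) (x y z a : R) :
  quot_within 0 pi (fun t => VQ beta Q x t z a) y -->
  Vfg beta sine dsine Q x y z a.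
Proof.
apply: quot_within_cvg_sum => n; apply: quot_within_cvg_sum => k.
apply: quot_within_cvg_sum => m.
by apply: quot_within_cvgZ; exact: quot_within_sine.
Qed.

Lemma dx4_vQq (R : realType) (N K : nat) (B1 B2 beta : R)
    (q : R -> R -> R -> R -> R) (Q : R -> 'I_N -> 'I_K -> 'I_K -> R) (x y z a : R) :
  0 < B1 -> C1_Ga B1 B2 q -> Ga B1 B2 (x, y, z, a) ->
  dx4 (vQq B1 beta q Q) x y z a
  = v0_dx B1 x y a + dx4 q x y z a + Vfg beta dsine sine Q x y z a.
Proof.
move=> B0 [dq _] c; have [qx _ _ _] := dq _ _ _ _ c.
have /GaE[xp _ _ _] := c; apply: D_withinE xp _; first exact: pi_gt0.
apply: quot_within_cvgD; last exact: quot_within_VQx.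
by apply: quot_within_cvgD; [exact: quot_within_v0x|exact: qx].
Qed.

Lemma dy4_vQq (R : realType) (N K : nat) (B1 B2 beta : R)
    (q : R -> R -> R -> R -> R) (Q : R -> 'I_N -> 'I_K -> 'I_K -> R) (x y z a : R) :
  0 < B1 -> C1_Ga B1 B2 q -> Ga B1 B2 (x, y, z, a) ->
  dy4 (vQq B1 beta q Q) x y z a
  = v0_dy B1 x y a + dy4 q x y z a + Vfg beta sine dsine Q x y z a.
Proof.
move=> B0 [dq _] c; have [_ qy _ _] := dq _ _ _ _ c.
have /GaE[_ yp _ _] := c; apply: D_withinE yp _; first exact: pi_gt0.
apply: quot_within_cvgD; last exact: quot_within_VQy.
by apply: quot_within_cvgD; [exact: quot_within_v0y|exact: qy].
Qed.

Lemma within_vQq (R : realType) (N K : nat) (B1 B2 beta : R)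
    (q : R -> R -> R -> R -> R) (Q : R -> 'I_N -> 'I_K -> 'I_K -> R) :
  0 < B1 -> C1_Ga B1 B2 q ->
  (forall n k m, {within `[B1, B2], continuous (fun z => Q z n k m)}) ->
  [/\ {within Ga B1 B2, continuous (unc4 (vQq B1 beta q Q))},
      {within Ga B1 B2, continuous (unc4 (dx4 (vQq B1 beta q Q)))} &
      {within Ga B1 B2, continuous (unc4 (dy4 (vQq B1 beta q Q)))}].
Proof.
move=> B0 Cq cQ; have [_ [cq cqx cqy _ _]] := Cq.
have [c0 c0x c0y] := cont_v0 B0.
have cs := @cont_sine R; have cd := @cont_dsine R.
split.
- have cV := within_Vfg (beta := beta) cs cs cQ.
  exact: contD (contD (continuous_subspaceT c0) cq) cV.
- have cV := within_Vfg (beta := beta) cd cs cQ.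
  apply: subspace_eq_continuous (contD (contD (continuous_subspaceT c0x) cqx) cV).
  move=> -[[[x y] z] a]; rewrite inE => c.
  exact: esym (dx4_vQq beta Q B0 Cq c).
- have cV := within_Vfg (beta := beta) cs cd cQ.
  apply: subspace_eq_continuous (contD (contD (continuous_subspaceT c0y) cqy) cV).
  move=> -[[[x y] z] a]; rewrite inE => c.
  exact: esym (dy4_vQq beta Q B0 Cq c).
Qed.

(** * Estimates for [E] *)

(** [E^x] and [E^y] with [v], its derivative and the boundary value as parameters. *)
Definition Egen {R : realType} (B2 : R) (v w : R -> R -> R -> R -> R)
    (b : R -> R -> R -> R) (x y z a : R) : R :=
  - (\int[lebesgue_measure]_(s in `[z, B2])
       (w x y s a / (2 * Num.sqrt (v x y s a)))) + b x y a.

Lemma within_quot_sqrt (R : realType) (T : topologicalType) (D : set T)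
    (kap : R) (v w : T -> R) : 0 < kap ->
  {within D, continuous v} -> {within D, continuous w} ->
  (forall X, D X -> kap <= v X) ->
  {within D, continuous (fun X => w X / (2 * Num.sqrt (v X)))}.
Proof.
move=> k0 cv cw kv.
(* Away from D the denominator may vanish; the maximum with kap does not. *)
apply: (@subspace_eq_continuous _ _ _
    (fun X => w X / (2 * Num.sqrt (Num.max kap (v X))))).
  move=> X; rewrite inE => DX.
  by rewrite /from_subspace max_r ?kv.
apply: (contM (T := subspace D)); first exact: cw.
apply: (contV (T := subspace D)).
  apply: (contM (T := subspace D)); first exact: cont_cst.
  apply: (cont_comp (@sqrt_continuous R)) => X.
  have -> : (fun X => Num.max kap (v X)) = (fun X => (kap + v X + `|kap - v X|) / 2).
    by apply/funext => Y; rewrite maxr_absE.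
  have c := @cont_cst (subspace D) R.
  have h : {within D, continuous (fun X => (kap + v X + `|kap - v X|) / 2)}.
    apply: contM; last exact: c.
    by apply: contD; [exact: contD|apply: cont_norm; exact: contB].
  exact: h.
by move=> X; rewrite mulf_neq0// gt_eqF// sqrtr_gt0 lt_max k0.
Qed.

Lemma within_line (R : realType) (B1 B2 : R) (f : R -> R -> R -> R -> R) x y z a :
  {within Ga B1 B2, continuous (unc4 f)} -> Ga B1 B2 (x, y, z, a) ->
  {within `[z, B2], continuous (fun s => f x y s a)}.
Proof.
move=> cf /GaE[xp yp /andP[z1 z2] ap].
have c : {within `[z, B2], continuous (fun s : R => (x, y, s, a))}.
  apply: continuous_subspaceT; apply: cont_pair (cont_cst (c := a)).
  exact: cont_pair (cont_cst (c := (x, y))) (@cont_id R).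
apply: (within_comp cf c) => s; rewrite /= in_itv/= => /andP[s1 s2].
by apply/GaE; split=> //; rewrite s2 (le_trans z1).
Qed.

Lemma within_Egen (R : realType) (B1 B2 kap z : R) (v w : R -> R -> R -> R -> R)
    (b : R -> R -> R -> R) : 0 < kap -> B1 <= z <= B2 ->
  {within Ga B1 B2, continuous (unc4 v)} -> {within Ga B1 B2, continuous (unc4 w)} ->
  (forall X, Ga B1 B2 X -> kap <= unc4 v X) ->
  {within cube, continuous (unc3 b)} ->
  {within cube, continuous (unc3 (fun x y a => Egen B2 v w b x y z a))}.
Proof.
move=> k0 /andP[z1 z2] cv cw kv cb; apply: contD cb; apply: contN.
apply: (within_Rintegral_param (F := fun X s =>
  w X.1.1 X.1.2 s X.2 / (2 * Num.sqrt (v X.1.1 X.1.2 s X.2)))) => //.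
have c : {within (cube `*` `[z, B2])%classic, continuous
    (fun X : (R * R * R) * R => (X.1.1.1, X.1.1.2, X.2, X.1.2))}.
  apply: continuous_subspaceT.
  apply: cont_pair (cont_snd (cont_fst (@cont_id _))).
  apply: cont_pair (cont_snd (@cont_id _)).
  exact: cont_pair (cont_fst (cont_fst (cont_fst (@cont_id _))))
    (cont_snd (cont_fst (cont_fst (@cont_id _)))).
apply: (within_comp (within_quot_sqrt k0 cv cw kv) c).
move=> [[[x y] a] s] [/cubeE[xp yp ap]]; rewrite /= in_itv/= => /andP[s1 s2].
by apply/GaE; split=> //; rewrite s2 (le_trans z1).
Qed.

(** Lipschitz constant of [(v, w) |-> w / (2 sqrt v)] on [v >= kap], [|w| <= W]. *)
Definition quot_sqrt_lip {R : realType} (kap W : R) : R :=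
  (2 * Num.sqrt kap)^-1 + W / (4 * kap * Num.sqrt kap).

Lemma quot_sqrt_le (R : realType) (kap v w h : R) : 0 < kap -> kap <= v ->
  `|w| <= h -> `|w / (2 * Num.sqrt v)| <= (2 * Num.sqrt kap)^-1 * h.
Proof.
move=> k0 kv wh; have v0 := lt_le_trans k0 kv.
rewrite normrM mulrC ler_pM// normfV ger0_norm ?mulr_ge0 ?sqrtr_ge0//.
by rewrite lef_pV2 ?posrE ?mulr_gt0 ?sqrtr_gt0// ler_pM2l// ler_sqrt// ltW.
Qed.

Lemma quot_sqrt_dist_le (R : realType) (kap W v1 v2 w1 w2 h : R) :
  0 < kap -> kap <= v1 -> kap <= v2 -> `|w2| <= W ->
  `|v1 - v2| <= h -> `|w1 - w2| <= h ->
  `|w1 / (2 * Num.sqrt v1) - w2 / (2 * Num.sqrt v2)| <= quot_sqrt_lip kap W * h.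
Proof.
move=> k0 kv1 kv2 wW vh wh.
have p1 := lt_le_trans k0 kv1; have p2 := lt_le_trans k0 kv2.
set r1 := Num.sqrt v1; set r2 := Num.sqrt v2; set rk := Num.sqrt kap.
have r10 : 0 < r1 by rewrite sqrtr_gt0.
have r20 : 0 < r2 by rewrite sqrtr_gt0.
have rk0 : 0 < rk by rewrite sqrtr_gt0.
have kr1 : rk <= r1 by rewrite ler_sqrt// ltW.
have kr2 : rk <= r2 by rewrite ler_sqrt// ltW.
have e1 : v1 = r1 * r1 by rewrite -expr2 sqr_sqrtr// ltW.
have e2 : v2 = r2 * r2 by rewrite -expr2 sqr_sqrtr// ltW.
have ek : kap = rk * rk by rewrite -expr2 sqr_sqrtr// ltW.
(* The difference is split at w2 / (2 r1), and r1 - r2 = (v1 - v2) / (r1 + r2). *)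
have -> : w1 / (2 * r1) - w2 / (2 * r2) =
    (w1 - w2) / (2 * r1) - w2 * (v1 - v2) / (2 * r1 * r2 * (r1 + r2)).
  by rewrite e1 e2; field; rewrite !gt_eqF ?addr_gt0.
apply: le_trans (ler_normB _ _) _.
rewrite /quot_sqrt_lip [leRHS]mulrDl -/rk; apply: lerD; first exact: quot_sqrt_le.
have h0 : 0 <= h by apply: le_trans vh.
rewrite normrM normrM mulrAC; apply: ler_pM => //.
apply: ler_pM => //; rewrite normfV ger0_norm; last first.
  by rewrite !mulr_ge0 ?addr_ge0// ltW.
rewrite lef_pV2 ?posrE ?mulr_gt0 ?addr_gt0//.
have -> : 4 * kap * rk = 2 * rk * rk * (rk + rk) by rewrite ek; ring.
apply: ler_pM; [by rewrite !mulr_ge0// ltW|by rewrite addr_ge0// ltW| |exact: lerD].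
by apply: ler_pM => //; [by rewrite mulr_ge0// ltW|exact: ltW|by rewrite ler_pM2l].
Qed.

Lemma Egen_le (R : realType) (B1 B2 kap C : R) (v w : R -> R -> R -> R -> R)
    (b : R -> R -> R -> R) (h : R -> R) x y z a : 0 < kap ->
  Ga B1 B2 (x, y, z, a) ->
  {within Ga B1 B2, continuous (unc4 v)} -> {within Ga B1 B2, continuous (unc4 w)} ->
  {within `[z, B2], continuous h} ->
  (forall X, Ga B1 B2 X -> kap <= unc4 v X) ->
  (forall s, z <= s <= B2 -> `|w x y s a| <= h s) ->
  `|b x y a| <= C ->
  `|Egen B2 v w b x y z a|
  <= (2 * Num.sqrt kap)^-1 * \int[lebesgue_measure]_(s in `[z, B2]) h s + C.
Proof.
move=> k0 c cv cw ch kv wh bC; rewrite /Egen.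
apply: le_trans (ler_normD _ _) _; rewrite normrN lerD//.
have c0 : {within `[z, B2], continuous (fun _ : R => 0 : R)} by exact: cont_cst.
have cq := within_line (f := fun x y s a => w x y s a / (2 * Num.sqrt (v x y s a)))
  (within_quot_sqrt k0 cv cw kv) c.
have ck : {within `[z, B2], continuous (fun s => (2 * Num.sqrt kap)^-1 * h s)}.
  by apply: contM ch; exact: cont_cst.
have [_ _ /andP[z1 z2] _] := (GaE B1 B2 x y z a).1 c.
have := Rintegral_dist_le cq c0 ck.
rewrite Rintegral_cst_seg// mul0r subr0 RintegralZl//; last exact: integrable_seg.
apply=> s /andP[s1 s2]; rewrite subr0; apply: quot_sqrt_le => //; last first.
  by apply: wh; rewrite s1.
apply: (kv (x, y, s, a)); have /GaE[xp yp _ ap] := c; apply/GaE; split=> //.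
by rewrite s2 (le_trans z1).
Qed.

Lemma Egen_dist_le (R : realType) (B1 B2 kap W e : R)
    (v1 w1 v2 w2 : R -> R -> R -> R -> R) (b1 b2 : R -> R -> R -> R) (h : R -> R)
    x y z a : 0 < kap ->
  Ga B1 B2 (x, y, z, a) ->
  {within Ga B1 B2, continuous (unc4 v1)} ->
  {within Ga B1 B2, continuous (unc4 w1)} ->
  {within Ga B1 B2, continuous (unc4 v2)} ->
  {within Ga B1 B2, continuous (unc4 w2)} ->
  {within `[z, B2], continuous h} ->
  (forall X, Ga B1 B2 X -> kap <= unc4 v1 X) ->
  (forall X, Ga B1 B2 X -> kap <= unc4 v2 X) ->
  (forall s, z <= s <= B2 -> `|w2 x y s a| <= W) ->
  (forall s, z <= s <= B2 -> `|v1 x y s a - v2 x y s a| <= h s) ->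
  (forall s, z <= s <= B2 -> `|w1 x y s a - w2 x y s a| <= h s) ->
  `|b1 x y a - b2 x y a| <= e ->
  `|Egen B2 v1 w1 b1 x y z a - Egen B2 v2 w2 b2 x y z a|
  <= quot_sqrt_lip kap W * \int[lebesgue_measure]_(s in `[z, B2]) h s + e.
Proof.
move=> k0 c cv1 cw1 cv2 cw2 ch kv1 kv2 wW vh wh be; rewrite /Egen.
rewrite opprD addrACA; apply: le_trans (ler_normD _ _) _; apply: lerD => //.
rewrite -opprD normrN.
have cq1 := within_line (f := fun x y s a => w1 x y s a / (2 * Num.sqrt (v1 x y s a)))
  (within_quot_sqrt k0 cv1 cw1 kv1) c.
have cq2 := within_line (f := fun x y s a => w2 x y s a / (2 * Num.sqrt (v2 x y s a)))
  (within_quot_sqrt k0 cv2 cw2 kv2) c.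
have ck : {within `[z, B2], continuous (fun s => quot_sqrt_lip kap W * h s)}.
  by apply: contM ch; exact: cont_cst.
have [xp yp /andP[z1 z2] ap] := (GaE B1 B2 x y z a).1 c.
have := Rintegral_dist_le cq1 cq2 ck.
rewrite RintegralZl//; last exact: integrable_seg.
apply=> s sz; have /andP[s1 s2] := sz.
have sG : Ga B1 B2 (x, y, s, a).
  by apply/GaE; split=> //; rewrite s2 (le_trans z1).
by apply: quot_sqrt_dist_le; [|exact: (kv1 _ sG)|exact: (kv2 _ sG)|exact: wW|
  exact: vh|exact: wh].
Qed.

(** * A priori bounds *)

Lemma Rintegral_subset_le (R : realType) (a b c : R) (f : R -> R) :
  a <= c ->
  {within `[a, b], continuous f} -> (forall t, 0 <= f t) ->
  \int[lebesgue_measure]_(t in `[c, b]) f t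
  <= \int[lebesgue_measure]_(t in `[a, b]) f t.
Proof.
move=> ac cf f0.
have sub : [set` `[c, b]] `<=` [set` `[a, b]].
  by apply: subset_itvr; rewrite bnd_simp.
have cf' : {within `[c, b], continuous f} by exact: continuous_subspaceW sub cf.
apply: fine_le.
- by apply: integrable_fin_num => //; exact: integrable_seg.
- by apply: integrable_fin_num => //; exact: integrable_seg.
- apply: ge0_subset_integral => //.
  + by have /integrableP[] := integrable_seg cf.
  + by move=> t _; rewrite lee_fin.
Qed.

Lemma Rintegral_sum_le (R : realType) (a b c : R) (I : finType) (f : I -> R -> R) :
  (forall i, {within `[a, b], continuous (f i)}) ->
  (forall i, \int[lebesgue_measure]_(t in `[a, b]) f i t <= c) ->
  \int[lebesgue_measure]_(t in `[a, b]) (\sum_i f i t) <= #|I|%:R * c.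
Proof.
move=> cf fc; rewrite mulr_natl -sumr_const.
rewrite (_ : \int[lebesgue_measure]_(t in _) _ =
    \sum_i \int[lebesgue_measure]_(t in `[a, b]) f i t); first exact: ler_sum.
elim: (index_enum I) => [|i r ih].
  rewrite big_nil; under eq_Rintegral do rewrite big_nil.
  by rewrite /Rintegral integral0.
rewrite big_cons; under eq_Rintegral do rewrite big_cons.
by rewrite RintegralD ?ih//; apply: integrable_seg => //; exact: cont_sum.
Qed.

Lemma within_norm1 (R : realType) (N K : nat) (B1 B2 : R)
    (w : R -> 'I_N -> 'I_K -> 'I_K -> R) :
  (forall n k m, {within `[B1, B2], continuous (fun z => w z n k m)}) ->
  {within `[B1, B2], continuous (fun z => norm1 (w z))}.
Proof. by move=> cw; do 3![apply: cont_sum => ?]; apply: cont_norm; exact: cw. Qed.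

(** The weak derivative only adds to the [H^1] norm, so the [L^2] norm suffices:
    [|w| <= 1 + w^2] bounds the integral. *)
Lemma Rintegral_norm_H1 (R : realType) (B1 B2 r : R) (w : R -> R) : B1 <= B2 ->
  {within `[B1, B2], continuous w} -> H1norm B1 B2 w <= r ->
  \int[lebesgue_measure]_(s in `[B1, B2]) `|w s| <= (B2 - B1) + r ^+ 2.
Proof.
move=> hB cw wr.
have cw2 : {within `[B1, B2], continuous (fun s => w s * w s)} by exact: contM.
have c1 : {within `[B1, B2], continuous (fun _ : R => 1 : R)} by exact: cont_cst.
apply: (@le_trans _ _ (\int[lebesgue_measure]_(s in `[B1, B2]) (1 + w s * w s))).
  apply: le_Rintegral => //.
  - by apply: integrable_seg; exact: cont_norm.
  - by apply: integrable_seg; exact: contD.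
  - move=> s _; have := sqr_ge0 (`|w s| - 1).
    have -> : w s * w s = `|w s| ^+ 2 by rewrite real_normK ?num_real// expr2.
    by have := normr_ge0 (w s); move: `|w s| => t; nra.
rewrite RintegralD//; [|exact: integrable_seg..].
rewrite Rintegral_cst_seg// mul1r lerD2l.
have : H1norm B1 B2 w ^+ 2 <= r ^+ 2.
  have h0 : 0 <= H1norm B1 B2 w by exact: sqrtr_ge0.
  by rewrite ler_pXn2r// nnegrE// (le_trans h0).
apply: le_trans; rewrite /H1norm sqr_sqrtr.
  by rewrite lerDl; apply: Rintegral_ge0 => t _; rewrite -expr2 sqr_ge0.
by apply: addr_ge0; apply: Rintegral_ge0 => t _; rewrite -expr2 sqr_ge0.
Qed.

Lemma vec_norm_ub (R : realType) (N K : nat) (norm : (R -> R) -> R)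
    (Q : R -> 'I_N -> 'I_K -> 'I_K -> R) n k m :
  `|norm (fun z => Q z n k m)| <= vec_norm norm Q.
Proof.
rewrite /vec_norm -sqrtr_sqr ler_wsqrtr// (bigD1 n)//= (bigD1 k)//= (bigD1 m)//=.
by rewrite -!addrA lerDl !addr_ge0//; do ?[apply: sumr_ge0 => ? _]; exact: sqr_ge0.
Qed.

Lemma vec_norm_le (R : realType) (N K : nat) (norm : (R -> R) -> R) (c : R)
    (Q : R -> 'I_N -> 'I_K -> 'I_K -> R) :
  (0 < N)%N -> (0 < K)%N -> 0 <= c ->
  (forall n k m, `|norm (fun z => Q z n k m)| <= c) ->
  vec_norm norm Q <= (N * K * K)%:R * c.
Proof.
move=> N0 K0 c0 h; set T : R := (N * K * K)%:R.
have T1 : 1 <= T by rewrite ler1n !muln_gt0 N0 K0.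
have Tc0 : 0 <= T * c by rewrite mulr_ge0.
rewrite /vec_norm -[leRHS]ger0_norm// -sqrtr_sqr ler_wsqrtr//.
apply: (@le_trans _ _ (T * c ^+ 2)).
  have := @norm1_le R N K (fun n k m => norm (fun z => Q z n k m) ^+ 2) (c ^+ 2).
  move=> h2; apply: le_trans (h2 _).
    by do 3![apply: ler_sum => ? _]; exact: ler_norm.
  move=> n k m; rewrite ger0_norm ?sqr_ge0// -real_normK ?num_real//.
  by rewrite ler_pXn2r ?nnegrE.
by rewrite exprMn ler_wpM2r ?sqr_ge0// expr2 ler_pMr// (lt_le_trans ltr01).
Qed.

Section Estimates.
Variables (R : realType) (N K : nat) (B1 B2 beta rad A d M P V : R).
Hypotheses (hB1 : 0 < B1) (hB : B1 < B2) (hN : (0 < N)%N) (hK : (0 < K)%N).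
Hypothesis hA : 0 < A.
Hypothesis hd : 0 < d < B1 ^+ 2 / (B1 ^+ 2 + 5 * pi ^+ 2 / 4).
Hypothesis hM : forall i j, `|invmx (Lambda_mx N beta) i j| <= M.
Hypothesis hP : forall (l : 'I_N) a, 0 <= a <= pi ->
  `|phi beta l a| <= P /\ `|derive1 (phi beta l) a| <= P.
Hypothesis hV : forall (n : 'I_N) (k m : 'I_K), `|v0hat B1 beta n k m| <= V.

Local Notation T := ((N * K * K)%:R : R).
Local Notation L := (P * K%:R).
Local Notation CL := (Lambda_const N M P).

(** The positive lower bound of [v]. *)
Definition kap : R := B1 ^+ 2 / (B1 ^+ 2 + 5 * pi ^+ 2 / 4) - d.

(** Bounds for the integral of [norm1 Q], for [E], for [norm1 Q] and for the
    derivatives of [v], each obtained from the preceding one. *)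
Definition bound_intQ : R := T * ((B2 - B1) + rad ^+ 2).
Definition bound_E : R :=
  (2 * Num.sqrt kap)^-1 * ((v0_deriv_bound B1 + A) * (B2 - B1) + L * bound_intQ) + A.
Definition bound_Q : R := T * (CL * (2 * bound_E ^+ 2) + V + CL * A).
Definition bound_dv : R := v0_deriv_bound B1 + A + L * bound_Q.

Definition admissible (p q : R -> R -> R -> R -> R)
    (Q : R -> 'I_N -> 'I_K -> 'I_K -> R) : Prop :=
  [/\ C1_cube (fun x y a => p x y B2 a) /\ C1_Ga B1 B2 q,
      C1norm_cube (fun x y a => p x y B2 a) <= A,
      C1norm_Ga B1 B2 q <= A,
      ball_Rqd B1 B2 beta rad q d Q &
      solution B1 B2 beta p q Q].

Lemma kap_gt0 : 0 < kap.
Proof. by rewrite subr_gt0; case/andP: hd. Qed.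

Lemma P_ge0 : 0 <= P.
Proof.
have z : 0 <= (0 : R) <= pi by rewrite lexx pi_ge0.
by have [+ _] := hP (Ordinal hN) z; apply: le_trans.
Qed.

Lemma M_ge0 : 0 <= M.
Proof. by apply: le_trans (hM (Ordinal hN) (Ordinal hN)). Qed.

Lemma CL_ge0 : 0 <= CL.
Proof.
have := P_ge0; have := M_ge0; have := pi_ge0 R => p0 M0 P0.
by rewrite /Lambda_const !mulr_ge0// addr_ge0.
Qed.

Lemma L_ge0 : 0 <= L.
Proof. by rewrite mulr_ge0// P_ge0. Qed.

Lemma ExE p q Q x y z a : Ex B1 B2 beta p q Q x y z a =
  Egen B2 (vQq (K := K) (N := N) B1 beta q Q) (dx4 (vQq B1 beta q Q))
    (dx3 (fun x y a => p x y B2 a)) x y z a.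
Proof. by []. Qed.

Lemma EyE p q Q x y z a : Ey B1 B2 beta p q Q x y z a =
  Egen B2 (vQq (K := K) (N := N) B1 beta q Q) (dy4 (vQq B1 beta q Q))
    (dy3 (fun x y a => p x y B2 a)) x y z a.
Proof. by []. Qed.

Lemma Vfg_bound (f g : nat -> R -> R) Q x y z a :
  (forall k m : 'I_K, `|f k x * g m y| <= K%:R) -> 0 <= a <= pi ->
  `|Vfg (N := N) (K := K) beta f g Q x y z a| <= L * norm1 (Q z).
Proof. by move=> fg ap; apply: Vfg_le => // n; have [] := hP n ap. Qed.

Lemma admissible_cont p q Q : admissible p q Q ->
  [/\ {within Ga B1 B2, continuous (unc4 (vQq B1 beta q Q))},
      {within Ga B1 B2, continuous (unc4 (dx4 (vQq B1 beta q Q)))},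
      {within Ga B1 B2, continuous (unc4 (dy4 (vQq B1 beta q Q)))} &
      {within `[B1, B2], continuous (fun z => norm1 (Q z))}].
Proof.
move=> [[_ Cq] _ _ [cQ _ _] _].
have cQ' n k m : {within `[B1, B2], continuous (fun z => Q z n k m)}.
  by have [] := cQ n k m.
have [? ? ?] := within_vQq beta hB1 Cq cQ'.
by split=> //; exact: within_norm1.
Qed.

Lemma vQq_ge p q Q X : admissible p q Q -> Ga B1 B2 X ->
  kap <= unc4 (vQq B1 beta q Q) X.
Proof.
move: X => [[[x y] z] a] [_ _ _ [_ _ hq] _] c; have /GaE[xp yp zp ap] := c.
have := hq x y z a c; have := v0_ge hB1 xp yp ap.
rewrite /kap /unc4 /vQq /=.
move: (v0 _ _ _ _) (_ / _) (q _ _ _ _) (VQ _ _ _ _ _ _) => s1 s2 s3 s4.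
by lra.
Qed.

Lemma dv_le p q Q x y z a : admissible p q Q -> Ga B1 B2 (x, y, z, a) ->
  `|dx4 (vQq B1 beta q Q) x y z a|
    <= v0_deriv_bound B1 + A + L * norm1 (Q z) /\
  `|dy4 (vQq B1 beta q Q) x y z a|
    <= v0_deriv_bound B1 + A + L * norm1 (Q z).
Proof.
move=> [[_ Cq] _ qA _ _] c; have /GaE[xp yp zp ap] := c.
have [_ qx qy _] := C1norm_Ga_ub Cq c.
have [vx vy] := v0_deriv_le hB1 xp yp ap.
rewrite (dx4_vQq _ _ hB1 Cq c) (dy4_vQq _ _ hB1 Cq c).
split; apply: le_trans (ler_normD _ _) _; apply: lerD.
- apply: le_trans (ler_normD _ _) _; apply: lerD => //; exact: le_trans qA.
- by apply: Vfg_bound => // k m; exact: dsine_sine_le.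
- apply: le_trans (ler_normD _ _) _; apply: lerD => //; exact: le_trans qA.
- by apply: Vfg_bound => // k m; exact: sine_dsine_le.
Qed.

Lemma integral_norm1_le p q Q z : admissible p q Q -> B1 <= z <= B2 ->
  \int[lebesgue_measure]_(s in `[z, B2]) norm1 (Q s) <= bound_intQ.
Proof.
move=> adm /andP[z1 z2]; have [_ _ _ [cQ Qr _] _] := adm.
have cQ' n k m : {within `[B1, B2], continuous (fun z => Q z n k m)}.
  by have [] := cQ n k m.
have cn n k m : {within `[B1, B2], continuous (fun z => `|Q z n k m|)}.
  by apply: cont_norm; exact: cQ'.
have [_ _ _ c1] := admissible_cont adm.
apply: (@le_trans _ _ (\int[lebesgue_measure]_(s in `[B1, B2]) norm1 (Q s))).
  by apply: Rintegral_subset_le => // s; exact: norm1_ge0.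
have -> : bound_intQ =
    #|'I_N|%:R * (#|'I_K|%:R * (#|'I_K|%:R * ((B2 - B1) + rad ^+ 2))).
  by rewrite /bound_intQ !card_ord !natrM; ring.
apply: Rintegral_sum_le => n; first by do 2![apply: cont_sum => ?]; exact: cn.
apply: Rintegral_sum_le => k; first by apply: cont_sum => ?; exact: cn.
apply: Rintegral_sum_le => m; first exact: cn.
apply: Rintegral_norm_H1 => //; first exact: ltW.
apply: le_trans (ltW Qr); apply: le_trans (ler_norm _) _.
exact: (vec_norm_ub (H1norm B1 B2)).
Qed.

Lemma E_le p q Q x y z a : admissible p q Q -> Ga B1 B2 (x, y, z, a) ->
  `|Ex B1 B2 beta p q Q x y z a| <= bound_E /\
  `|Ey B1 B2 beta p q Q x y z a| <= bound_E.
Proof.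
move=> adm c; have /GaE[xp yp zp ap] := c; have /andP[z1 z2] := zp.
have [cv cvx cvy c1] := admissible_cont adm.
have [[Cp Cq] pA qA _ _] := adm.
have cc : cube (x, y, a) by apply/cubeE.
have [px py] := C1norm_cube_ub Cp cc.
have kv X := vQq_ge (X := X) adm.
pose h s := v0_deriv_bound B1 + A + L * norm1 (Q s).
have sub : [set` `[z, B2]] `<=` [set` `[B1, B2]].
  by apply: subset_itvr; rewrite bnd_simp.
have c1z : {within `[z, B2], continuous (fun s => norm1 (Q s))}.
  exact: continuous_subspaceW sub c1.
have cL : {within `[z, B2], continuous (fun s => L * norm1 (Q s))}.
  by apply: contM c1z; exact: cont_cst.
have ck : {within `[z, B2], continuous (fun _ : R => v0_deriv_bound B1 + A)}.
  exact: cont_cst.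
have ch : {within `[z, B2], continuous h} by exact: contD.
have G0 : 0 <= v0_deriv_bound B1.
  by have [+ _] := v0_deriv_le hB1 xp yp ap; apply: le_trans.
have sG s : z <= s <= B2 -> Ga B1 B2 (x, y, s, a).
  by move=> /andP[s1 s2]; apply/GaE; split=> //; rewrite s2 (le_trans z1).
have ih : \int[lebesgue_measure]_(s in `[z, B2]) h s <=
    (v0_deriv_bound B1 + A) * (B2 - B1) + L * bound_intQ.
  rewrite RintegralD//; [|exact: integrable_seg..].
  rewrite Rintegral_cst_seg// RintegralZl//; last exact: integrable_seg.
  apply: lerD; last by rewrite ler_wpM2l ?L_ge0// (integral_norm1_le adm).
  by apply: ler_wpM2l; [rewrite addr_ge0// ltW|rewrite lerD2l lerN2].
have k0 : 0 <= (2 * Num.sqrt kap)^-1.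
  by rewrite invr_ge0 mulr_ge0// sqrtr_ge0.
have fin w b : `|Egen B2 (vQq B1 beta q Q) w b x y z a| <=
    (2 * Num.sqrt kap)^-1 * \int[lebesgue_measure]_(s in `[z, B2]) h s + A ->
    `|Egen B2 (vQq B1 beta q Q) w b x y z a| <= bound_E.
  by move=> h1; apply: le_trans h1 _; rewrite lerD2r ler_wpM2l.
rewrite ExE EyE; split; apply: fin; apply: (Egen_le kap_gt0 c cv _ ch kv) => //.
- by move=> s sz; have [] := dv_le adm (sG s sz).
- exact: le_trans px pA.
- by move=> s sz; have [] := dv_le adm (sG s sz).
- exact: le_trans py pA.
Qed.

Lemma within_E p q Q z : admissible p q Q -> B1 <= z <= B2 ->
  {within cube, continuous (unc3 (fun x y a =>
     Ex B1 B2 beta p q Q x y z a ^+ 2 + Ey B1 B2 beta p q Q x y z a ^+ 2))}.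
Proof.
move=> adm zp; have [cv cvx cvy _] := admissible_cont adm.
have [[[_ [_ cpx cpy _]] _] _ _ _ _] := adm.
have kv X := vQq_ge (X := X) adm.
exact: contD (contX (within_Egen kap_gt0 zp cv cvx kv cpx))
  (contX (within_Egen kap_gt0 zp cv cvy kv cpy)).
Qed.

Lemma Lambda_zero inner (n : 'I_N) (k m : 'I_K) :
  (forall l, inner beta l (fun=> 0) = 0) ->
  Lambda beta inner (fun _ _ _ => 0) n k m = 0.
Proof.
move=> h; rewrite /Lambda mxE big1// => l _; rewrite [X in _ * X]mxE.
under eq_Rintegral do under eq_Rintegral do rewrite h !mul0r.
under eq_Rintegral do rewrite Rintegral_cst_seg ?pi_ge0// mul0r.
by rewrite Rintegral_cst_seg ?pi_ge0// mul0r oppr0 mulr0.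
Qed.

Lemma D_within_cst0 t : 0 <= t <= pi -> D_within 0 pi (fun=> 0 : R) t = 0.
Proof.
move=> tp; apply: D_withinE tp _; first exact: pi_gt0.
by apply: quot_within_is_derive; exact: is_derive_cst.
Qed.

Lemma inner_C1_0 l : inner_C1 beta l (fun=> 0) = 0 :> R.
Proof.
rewrite /inner_C1 -[RHS](mul0r (pi - 0)) -Rintegral_cst_seg ?pi_ge0//.
apply: eq_Rintegral => t; rewrite inE/= in_itv/= => tp.
by rewrite D_within_cst0// mul0r.
Qed.

Lemma inner_C0_0 l : inner_C0 beta l (fun=> 0) = 0 :> R.
Proof.
rewrite /inner_C0 !mul0r subrr sub0r -[RHS]oppr0; congr (- _).
rewrite -[RHS](mul0r (pi - 0)) -Rintegral_cst_seg ?pi_ge0//.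
by apply: eq_Rintegral => t _; rewrite mul0r.
Qed.

Lemma qhat_cont p q Q z : admissible p q Q -> B1 <= z <= B2 ->
  {within cube, continuous (unc3 (da3 (fun x y a => q x y z a)))}.
Proof.
move=> [[_ [_ [_ _ _ _ cqa]]] _ _ _ _] zp.
have c : {within cube, continuous (fun X : R * R * R => (X.1.1, X.1.2, z, X.2))}.
  apply: continuous_subspaceT; apply: cont_pair (cont_snd (@cont_id _)).
  apply: cont_pair (cont_cst (c := z)).
  exact: cont_pair (cont_fst (cont_fst (@cont_id _))) (cont_snd (cont_fst (@cont_id _))).
by apply: (within_comp cqa c) => -[[x y] a] /cubeE[xp yp ap]; apply/GaE.
Qed.

(** The equation for [Q] turns the integral bound into a pointwise one. *)
Lemma norm1_Q_le p q Q z : admissible p q Q -> B1 <= z <= B2 ->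
  norm1 (Q z) <= bound_Q.
Proof.
move=> adm zp; have [[_ Cq] _ qA _ [sol _]] := adm.
apply: norm1_le => n k m; rewrite (sol z zp).
apply: le_trans (ler_normD _ _) _; apply: lerD.
  apply: le_trans (ler_normD _ _) _; apply: lerD => //.
  rewrite -[X in `|X|]subr0 -(Lambda_zero n k m inner_C0_0).
  apply: Lambda_C0_dist_le => //.
  - exact: within_E adm zp.
  - exact: cont_cst.
  - move=> x y a /cubeE[xp yp ap]; rewrite subr0.
    have c : Ga B1 B2 (x, y, z, a) by apply/GaE.
    have [ex ey] := E_le adm c.
    rewrite ger0_norm ?addr_ge0 ?sqr_ge0// mulr_natl mulr2n.
    have b0 : 0 <= bound_E by apply: le_trans ex.
    by apply: lerD; rewrite -real_normK ?num_real// ler_pXn2r ?nnegrE.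
rewrite -[X in `|X|]subr0 -(Lambda_zero n k m inner_C1_0).
apply: Lambda_C1_dist_le => //.
- exact: qhat_cont adm zp.
- apply: (@subspace_eq_continuous _ _ _ (fun=> 0)); last exact: cont_cst.
  move=> -[[x y] a]; rewrite inE => /cubeE[_ _ ap].
  exact: esym (D_within_cst0 ap).
- move=> x y a /cubeE[xp yp ap]; rewrite [X in _ - X]D_within_cst0// subr0.
  have c : Ga B1 B2 (x, y, z, a) by apply/GaE.
  by have [_ _ _ qa] := C1norm_Ga_ub Cq c; exact: le_trans qa qA.
Qed.


(** * Stability *)

(** For [t = int_z^B2 norm1 (Q1 - Q2)] and data at distance [e], [diff_E e t]
    bounds the difference of the values of [(E^x)^2 + (E^y)^2]. *)
Definition diff_E (e t : R) : R :=
  4 * bound_E * (quot_sqrt_lip kap bound_dv * (e * (B2 - B1) + L * t) + e).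

(** The inequality [D z <= gronwall_cst e + gronwall_coef int_z^B2 D] below feeds the
    Gronwall lemma; the summand 1 makes the coefficient positive. *)
Definition gronwall_coef : R :=
  T * (CL * (4 * bound_E * (quot_sqrt_lip kap bound_dv * L))) + 1.
Definition gronwall_cst : R :=
  T * (CL * (4 * bound_E * (quot_sqrt_lip kap bound_dv * (B2 - B1) + 1) + 1)).
Definition C_Q : R := 2 * gronwall_cst * expR (2 * gronwall_coef * (B2 - B1)).
Definition C_c : R := 1 + L * C_Q + diff_E 1 ((B2 - B1) * C_Q).

Lemma v0_deriv_bound_ge0 : 0 <= v0_deriv_bound B1.
Proof.
rewrite /v0_deriv_bound divr_ge0 ?sqr_ge0// mulr_ge0 ?sqr_ge0//.
by rewrite mulr_ge0 ?pi_ge0.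
Qed.

Lemma kap_inv_ge0 : 0 <= (2 * Num.sqrt kap)^-1.
Proof. by rewrite invr_ge0 mulr_ge0// sqrtr_ge0. Qed.

Lemma bound_intQ_ge0 : 0 <= bound_intQ.
Proof. by rewrite mulr_ge0// addr_ge0 ?sqr_ge0// subr_ge0 ltW. Qed.

Lemma bound_E_ge0 : 0 <= bound_E.
Proof.
apply: addr_ge0 (ltW hA); apply: mulr_ge0 kap_inv_ge0 _; apply: addr_ge0.
  apply: mulr_ge0; last by rewrite subr_ge0 ltW.
  exact: addr_ge0 v0_deriv_bound_ge0 (ltW hA).
exact: mulr_ge0 L_ge0 bound_intQ_ge0.
Qed.

Lemma V_ge0 : 0 <= V.
Proof. by apply: le_trans (hV (Ordinal hN) (Ordinal hK) (Ordinal hK)). Qed.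

Lemma bound_dv_ge0 : 0 <= bound_dv.
Proof.
have A0 := ltW hA; apply: addr_ge0; first exact: addr_ge0 v0_deriv_bound_ge0 A0.
apply: mulr_ge0 L_ge0 _; apply: mulr_ge0 => //; apply: addr_ge0.
  by apply: addr_ge0 V_ge0; apply: mulr_ge0 CL_ge0 _; rewrite mulr_ge0 ?sqr_ge0.
exact: mulr_ge0 CL_ge0 A0.
Qed.

Lemma lip_ge0 : 0 <= quot_sqrt_lip kap bound_dv.
Proof.
rewrite /quot_sqrt_lip addr_ge0 ?kap_inv_ge0// divr_ge0 ?bound_dv_ge0//.
by rewrite !mulr_ge0 ?sqrtr_ge0// ltW// kap_gt0.
Qed.

Lemma diff_E_le e t t' : t <= t' -> diff_E e t <= diff_E e t'.
Proof.
move=> tt; rewrite /diff_E ler_wpM2l ?mulr_ge0 ?bound_E_ge0//.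
by rewrite lerD2r ler_wpM2l ?lip_ge0// lerD2l ler_wpM2l ?L_ge0.
Qed.

Lemma C1norm_cube_ge0 u : 0 <= C1norm_cube (R := R) u.
Proof. by rewrite /C1norm_cube !addr_ge0// supnorm_ge0. Qed.

Lemma C1norm_Ga_ge0 u : 0 <= C1norm_Ga (R := R) B1 B2 u.
Proof. by rewrite /C1norm_Ga !addr_ge0// supnorm_ge0. Qed.

Lemma gronwall_cst_ge0 : 0 <= gronwall_cst.
Proof.
have := CL_ge0; have := bound_E_ge0; have := lip_ge0 => l0 b0 c0.
rewrite /gronwall_cst mulr_ge0// mulr_ge0// addr_ge0// mulr_ge0 ?mulr_ge0//.
by rewrite addr_ge0// mulr_ge0// subr_ge0 ltW.
Qed.

Lemma gronwall_coef_gt0 : 0 < gronwall_coef.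
Proof.
have := CL_ge0; have := bound_E_ge0; have := lip_ge0; have := L_ge0.
move=> L0 l0 b0 c0; rewrite ltr_wpDl// mulr_ge0// mulr_ge0// mulr_ge0 ?mulr_ge0//.
exact: P_ge0.
Qed.

Lemma C_Q_ge0 : 0 <= C_Q.
Proof. by rewrite /C_Q mulr_ge0 ?expR_ge0// mulr_ge0// gronwall_cst_ge0. Qed.

Lemma C_c_ge0 : 0 <= C_c.
Proof.
have := bound_E_ge0; have := lip_ge0; have := L_ge0; have := C_Q_ge0.
have b0 : 0 <= B2 - B1 by rewrite subr_ge0 ltW.
move=> q0 L0 l0 e0; apply: addr_ge0.
  by apply: addr_ge0 => //; exact: mulr_ge0.
apply: mulr_ge0; first exact: mulr_ge0.
apply: addr_ge0 => //; apply: mulr_ge0 => //; apply: addr_ge0.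
  exact: mulr_ge0.
by apply: mulr_ge0 => //; exact: mulr_ge0.
Qed.

Section Difference.
Variables (p1 q1 p2 q2 : R -> R -> R -> R -> R).
Variables (Q1 Q2 : R -> 'I_N -> 'I_K -> 'I_K -> R).
Hypotheses (adm1 : admissible p1 q1 Q1) (adm2 : admissible p2 q2 Q2).

Let e : R := C1norm_cube (fun x y a => p1 x y B2 a - p2 x y B2 a) +
  C1norm_Ga B1 B2 (fun x y z a => q1 x y z a - q2 x y z a).
Let D (z : R) : R := norm1 (fun n k m => Q1 z n k m - Q2 z n k m).

Lemma e_ge0 : 0 <= e.
Proof. by rewrite addr_ge0 ?C1norm_cube_ge0 ?C1norm_Ga_ge0. Qed.

Lemma q_dist x y z a : Ga B1 B2 (x, y, z, a) ->
  [/\ `|q1 x y z a - q2 x y z a| <= e,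
      `|dx4 q1 x y z a - dx4 q2 x y z a| <= e,
      `|dy4 q1 x y z a - dy4 q2 x y z a| <= e &
      `|da4 q1 x y z a - da4 q2 x y z a| <= e].
Proof.
move=> c; have [[_ Cq1] _ _ _ _] := adm1; have [[_ Cq2] _ _ _ _] := adm2.
have [Cq dE] := C1_GaB hB Cq1 Cq2; have [ex ey ea] := dE x y z a c.
have [u ux uy ua] := C1norm_Ga_ub Cq c; rewrite ex in ux; rewrite ey in uy.
rewrite ea in ua.
have le_e r : r <= C1norm_Ga B1 B2 (fun x y z a => q1 x y z a - q2 x y z a) -> r <= e.
  by move=> h; apply: le_trans h _; rewrite lerDr C1norm_cube_ge0.
by split; exact: le_e.
Qed.

Lemma p_dist x y a : cube (x, y, a) ->
  `|dx3 (fun x y a => p1 x y B2 a) x y a - dx3 (fun x y a => p2 x y B2 a) x y a| <= e /\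
  `|dy3 (fun x y a => p1 x y B2 a) x y a - dy3 (fun x y a => p2 x y B2 a) x y a| <= e.
Proof.
move=> c; have [[Cp1 _] _ _ _ _] := adm1; have [[Cp2 _] _ _ _ _] := adm2.
have [Cp dE] := C1_cubeB Cp1 Cp2; have [ex ey] := dE x y a c.
have [ux uy] := C1norm_cube_ub Cp c; rewrite ex in ux; rewrite ey in uy.
have le_e r : r <= C1norm_cube (fun x y a => p1 x y B2 a - p2 x y B2 a) -> r <= e.
  by move=> h; apply: le_trans h _; rewrite lerDl C1norm_Ga_ge0.
by split; exact: le_e.
Qed.

Lemma v_dist x y z a : Ga B1 B2 (x, y, z, a) ->
  [/\ `|vQq B1 beta q1 Q1 x y z a - vQq B1 beta q2 Q2 x y z a| <= e + L * D z,
      `|dx4 (vQq B1 beta q1 Q1) x y z a - dx4 (vQq B1 beta q2 Q2) x y z a|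
        <= e + L * D z &
      `|dy4 (vQq B1 beta q1 Q1) x y z a - dy4 (vQq B1 beta q2 Q2) x y z a|
        <= e + L * D z].
Proof.
move=> c; have [[_ Cq1] _ _ _ _] := adm1; have [[_ Cq2] _ _ _ _] := adm2.
have [u ux uy _] := q_dist c; have /GaE[xp yp zp ap] := c.
have sum (s t1 t2 V1 V2 : R) : `|t1 - t2| <= e -> `|V1 - V2| <= L * D z ->
    `|s + t1 + V1 - (s + t2 + V2)| <= e + L * D z.
  move=> h1 h2; rewrite (_ : _ - _ = (t1 - t2) + (V1 - V2)); last by ring.
  by apply: le_trans (ler_normD _ _) _; exact: lerD.
split.
- apply: sum => //; rewrite [X in `|X|](@VfgB R N K beta sine sine).
  by apply: Vfg_bound => // k m; exact: sine_sine_le.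
- rewrite (dx4_vQq _ _ hB1 Cq1 c) (dx4_vQq _ _ hB1 Cq2 c); apply: sum => //.
  by rewrite VfgB; apply: Vfg_bound => // k m; exact: dsine_sine_le.
- rewrite (dy4_vQq _ _ hB1 Cq1 c) (dy4_vQq _ _ hB1 Cq2 c); apply: sum => //.
  by rewrite VfgB; apply: Vfg_bound => // k m; exact: sine_dsine_le.
Qed.

Lemma within_D : {within `[B1, B2], continuous D}.
Proof.
have [_ _ _ [cQ1 _ _] _] := adm1; have [_ _ _ [cQ2 _ _] _] := adm2.
apply: within_norm1 => n k m.
by have [c1 _ _] := cQ1 n k m; have [c2 _ _] := cQ2 n k m; exact: contB.
Qed.

Lemma E_dist x y z a : Ga B1 B2 (x, y, z, a) ->
  `|(Ex B1 B2 beta p1 q1 Q1 x y z a ^+ 2 + Ey B1 B2 beta p1 q1 Q1 x y z a ^+ 2)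
    - (Ex B1 B2 beta p2 q2 Q2 x y z a ^+ 2 + Ey B1 B2 beta p2 q2 Q2 x y z a ^+ 2)|
  <= diff_E e (\int[lebesgue_measure]_(s in `[z, B2]) D s).
Proof.
move=> c; have /GaE[xp yp zp ap] := c; have /andP[z1 z2] := zp.
have [cv1 cvx1 cvy1 _] := admissible_cont adm1.
have [cv2 cvx2 cvy2 _] := admissible_cont adm2.
have kv1 X := vQq_ge (X := X) adm1; have kv2 X := vQq_ge (X := X) adm2.
have [ex1 ey1] := E_le adm1 c; have [ex2 ey2] := E_le adm2 c.
have sub : [set` `[z, B2]] `<=` [set` `[B1, B2]].
  by apply: subset_itvr; rewrite bnd_simp.
have cD : {within `[z, B2], continuous D}.
  exact: continuous_subspaceW sub within_D.
have cL : {within `[z, B2], continuous (fun s => L * D s)}.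
  by apply: contM cD; exact: cont_cst.
have ce : {within `[z, B2], continuous (fun _ : R => e)} by exact: cont_cst.
have ch : {within `[z, B2], continuous (fun s => e + L * D s)} by exact: contD.
have sG s : z <= s <= B2 -> Ga B1 B2 (x, y, s, a).
  by move=> /andP[s1 s2]; apply/GaE; split=> //; rewrite s2 (le_trans z1).
have W2 s : z <= s <= B2 -> `|dx4 (vQq B1 beta q2 Q2) x y s a| <= bound_dv /\
    `|dy4 (vQq B1 beta q2 Q2) x y s a| <= bound_dv.
  move=> sz; have [h1 h2] := dv_le adm2 (sG s sz).
  have /GaE[_ _ sB _] := sG s sz.
  have h : v0_deriv_bound B1 + A + L * norm1 (Q2 s) <= bound_dv.
    by rewrite lerD2l ler_wpM2l ?L_ge0// (norm1_Q_le adm2 sB).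
  by split; [exact: le_trans h1 h|exact: le_trans h2 h].
have cc : cube (x, y, a) by apply/cubeE.
have [px py] := p_dist cc.
set I := (X in diff_E e X).
have ih : \int[lebesgue_measure]_(s in `[z, B2]) (e + L * D s) <=
    e * (B2 - B1) + L * I.
  rewrite RintegralD//; [|exact: integrable_seg..].
  rewrite Rintegral_cst_seg// RintegralZl//; last exact: integrable_seg.
  by rewrite lerD2r ler_wpM2l ?e_ge0// lerD2l lerN2.
have fin t : t <= quot_sqrt_lip kap bound_dv *
      \int[lebesgue_measure]_(s in `[z, B2]) (e + L * D s) + e ->
    t <= quot_sqrt_lip kap bound_dv * (e * (B2 - B1) + L * I) + e.
  by move=> h; apply: le_trans h _; rewrite lerD2r ler_wpM2l ?lip_ge0.
have dx : `|Ex B1 B2 beta p1 q1 Q1 x y z a - Ex B1 B2 beta p2 q2 Q2 x y z a|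
    <= quot_sqrt_lip kap bound_dv * (e * (B2 - B1) + L * I) + e.
  rewrite !ExE; apply: fin; apply: (Egen_dist_le kap_gt0 c cv1 cvx1 cv2 cvx2 ch kv1 kv2) => //.
  - by move=> s sz; have [] := W2 s sz.
  - by move=> s sz; have [] := v_dist (sG s sz).
  - by move=> s sz; have [] := v_dist (sG s sz).
have dy : `|Ey B1 B2 beta p1 q1 Q1 x y z a - Ey B1 B2 beta p2 q2 Q2 x y z a|
    <= quot_sqrt_lip kap bound_dv * (e * (B2 - B1) + L * I) + e.
  rewrite !EyE; apply: fin; apply: (Egen_dist_le kap_gt0 c cv1 cvy1 cv2 cvy2 ch kv1 kv2) => //.
  - by move=> s sz; have [] := W2 s sz.
  - by move=> s sz; have [] := v_dist (sG s sz).
  - by move=> s sz; have [] := v_dist (sG s sz).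
rewrite /diff_E -/I.
move: ex1 ey1 ex2 ey2 dx dy.
move: (Ex _ _ _ _ _ _ _ _ _ _) (Ex _ _ _ _ _ _ _ _ _ _) => X2 X1.
move: (Ey _ _ _ _ _ _ _ _ _ _) (Ey _ _ _ _ _ _ _ _ _ _) => Y2 Y1.
move: (_ * (_ + _) + e) bound_E => r b h1 h2 h3 h4 h5 h6.
have sq (u v : R) : `|u| <= b -> `|v| <= b -> `|u - v| <= r ->
    `|u ^+ 2 - v ^+ 2| <= 2 * b * r.
  move=> ub vb uv; rewrite subr_sqr normrM mulrC; apply: ler_pM => //.
  by apply: le_trans (ler_normD _ _) _; rewrite mulr_natl mulr2n lerD.
rewrite (_ : _ - _ = (X1 ^+ 2 - X2 ^+ 2) + (Y1 ^+ 2 - Y2 ^+ 2)); last by ring.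
apply: le_trans (ler_normD _ _) _.
by have := sq _ _ h1 h3 h5; have := sq _ _ h2 h4 h6; move=> ? ?; lra.
Qed.

(** In the difference of the two equations the terms in [v0] cancel, and [Lambda] is
    bounded from the sup norm, applied to [(E^x)^2 + (E^y)^2] and to [da q]. *)
Lemma D_integral_le z : B1 <= z <= B2 ->
  D z <= gronwall_cst * e +
    gronwall_coef * \int[lebesgue_measure]_(s in `[z, B2]) D s.
Proof.
move=> zp; set I := (X in _ + _ * X).
have I0 : 0 <= I by apply: Rintegral_ge0 => s _; exact: norm1_ge0.
have [_ _ _ _ [sol1 _]] := adm1; have [_ _ _ _ [sol2 _]] := adm2.
apply: (@le_trans _ _ (T * (CL * diff_E e I + CL * e))).
  apply: norm1_le => n k m; rewrite (sol1 z zp) (sol2 z zp).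
  have sum (r s f1 f2 w g1 g2 : R) : `|f1 - f2| <= r -> `|g1 - g2| <= s ->
      `|f1 + w + g1 - (f2 + w + g2)| <= r + s.
    move=> h1 h2; rewrite (_ : _ - _ = (f1 - f2) + (g1 - g2)); last by ring.
    by apply: le_trans (ler_normD _ _) _; exact: lerD.
  apply: sum.
    apply: Lambda_C0_dist_le => //.
    - exact: within_E adm1 zp.
    - exact: within_E adm2 zp.
    - by move=> x y a /cubeE[xp yp ap]; apply: E_dist; apply/GaE.
  apply: Lambda_C1_dist_le => //.
  - exact: qhat_cont adm1 zp.
  - exact: qhat_cont adm2 zp.
  - move=> x y a /cubeE[xp yp ap].
    by have [|_ _ _ +] := @q_dist x y z a; [apply/GaE|].
rewrite /diff_E /gronwall_cst /gronwall_coef.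
rewrite -subr_ge0; set X := (X in 0 <= X); suff -> : X = I by [].
by rewrite /X; ring.
Qed.

Lemma D_le z : B1 <= z <= B2 -> D z <= C_Q * e.
Proof.
move=> zp.
have := gronwall_backward (ltW hB) gronwall_coef_gt0 within_D D_integral_le zp.
rewrite ger0_norm; last exact: mulr_ge0 gronwall_cst_ge0 e_ge0.
move=> h; apply: le_trans h _.
by rewrite le_eqVlt /C_Q; apply/orP; left; apply/eqP; ring.
Qed.

Lemma Q_stability :
  vec_norm (supnorm `[B1, B2]) (fun z n k m => Q1 z n k m - Q2 z n k m)
  <= T * (C_Q * e).
Proof.
have c0 : 0 <= C_Q * e by rewrite mulr_ge0 ?C_Q_ge0 ?e_ge0.
apply: vec_norm_le => // n k m; rewrite ger0_norm ?supnorm_ge0//.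
apply: supnorm_le => // z; rewrite /= in_itv/= => zp.
apply: le_trans (D_le zp).
exact: (norm1_ub (fun n k m => Q1 z n k m - Q2 z n k m)).
Qed.

Lemma c_stability c1 c2 :
  coefficient B1 B2 beta p1 q1 Q1 c1 -> coefficient B1 B2 beta p2 q2 Q2 c2 ->
  supnorm (closG B1 B2) (unc3 (fun x y z => c1 x y z - c2 x y z)) <= C_c * e.
Proof.
move=> hc1 hc2; apply: supnorm_le; first by rewrite mulr_ge0 ?C_c_ge0 ?e_ge0.
move=> [[x y] z]; rewrite /closG /box3 /unc3 /= !in_itv/= => -[[xp yp] zp].
(* The coefficient does not depend on the source position; take a = 0. *)
have c : Ga B1 B2 (x, y, z, 0) by apply/GaE; split=> //; rewrite lexx pi_ge0.
rewrite -(hc1 x y z 0 c) -(hc2 x y z 0 c).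
have [dv _ _] := v_dist c; have dE := E_dist c.
have Dz := D_le zp; have /andP[z1 z2] := zp.
have iD : \int[lebesgue_measure]_(s in `[z, B2]) D s <= (B2 - B1) * C_Q * e.
  apply: (@le_trans _ _
      (\int[lebesgue_measure]_(s in `[B1, B2]) D s)).
    apply: Rintegral_subset_le => //; first exact: within_D.
    by move=> s; exact: norm1_ge0.
  rewrite -mulrA mulrC -Rintegral_cst_seg; last exact: ltW.
  apply: le_Rintegral => //.
  - exact: integrable_seg within_D.
  - by apply: integrable_seg; exact: cont_cst.
  - by move=> s; rewrite /= in_itv/= => sB; exact: D_le.
have dE' := le_trans dE (diff_E_le e iD).
have LD : L * D z <= L * (C_Q * e) by rewrite ler_wpM2l ?L_ge0.
have -> : C_c * e = (e + L * (C_Q * e)) + diff_E e ((B2 - B1) * C_Q * e).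
  by rewrite /C_c /diff_E; ring.
apply: le_trans (lerD (le_trans dv _) dE'); last by rewrite lerD2l.
apply: le_trans (ler_normD _ _); rewrite le_eqVlt; apply/orP; left.
by apply/eqP; congr (`|_|); ring.
Qed.

End Difference.

End Estimates.

Theorem theorem5p1 (R : realType) (B1 B2 : R) (hB1 : 0 < B1) (hB : B1 < B2)
    (N K : nat) (hN : (1 <= N)%N) (hK : (1 <= K)%N)
    (rad A d : R) (hrad : 0 < rad) (hA : 0 < A)
    (hd : 0 < d < B1 ^+ 2 / (B1 ^+ 2 + 5 * pi ^+ 2 / 4)) :
  exists C2 : R, 0 < C2 /\
    forall beta : R, 0 < beta ->
    forall p1 q1 p2 q2 : R -> R -> R -> R -> R,
    data_pair B1 B2 p1 q1 ->
    data_pair B1 B2 p2 q2 ->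
    (forall x y z a, boundary1 B1 B2 (x, y, z) -> 0 < a < pi ->
       0 <= q1 x y z a) ->
    (forall x y z a, boundary1 B1 B2 (x, y, z) -> 0 < a < pi ->
       0 <= q2 x y z a) ->
    C1norm_cube (fun x y a => p1 x y B2 a) <= A ->
    C1norm_cube (fun x y a => p2 x y B2 a) <= A ->
    C1norm_Ga B1 B2 q1 <= A ->
    C1norm_Ga B1 B2 q2 <= A ->
    forall Q1 Q2 : R -> 'I_N -> 'I_K -> 'I_K -> R,
    ball_Rqd B1 B2 beta rad q1 d Q1 ->
    ball_Rqd B1 B2 beta rad q2 d Q2 ->
    solution B1 B2 beta p1 q1 Q1 ->
    solution B1 B2 beta p2 q2 Q2 ->
    forall c1 c2 : R -> R -> R -> R,
    coefficient B1 B2 beta p1 q1 Q1 c1 ->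
    coefficient B1 B2 beta p2 q2 Q2 c2 ->
    let delta :=
      C1norm_cube (fun x y a => p1 x y B2 a - p2 x y B2 a) +
      C1norm_Ga B1 B2 (fun x y z a => q1 x y z a - q2 x y z a) in
    vec_norm (supnorm `[B1, B2]) (fun z n k m => Q1 z n k m - Q2 z n k m)
      <= C2 * delta /\
    supnorm (closG B1 B2) (unc3 (fun x y z => c1 x y z - c2 x y z))
      <= C2 * delta.
Proof.
(* The shift beta is universally quantified after the constant; the bounds are
   taken at beta = 1 and hold for all beta. *)
pose M : R := \sum_(i < N) \sum_(j < N) `|invmx (Lambda_mx N 1) i j|.
pose P : R := \sum_(l < N) (supnorm `[0, pi] (phi 1 l) +
  supnorm `[0, pi] (derive1 (phi 1 l))).
pose V : R := norm1 (@v0hat R N K B1 1).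
have hM beta i j : `|invmx (@Lambda_mx R N beta) i j| <= M.
  have -> : Lambda_mx N beta = Lambda_mx N 1 by rewrite /Lambda_mx (phi_shift beta 1).
  rewrite /M (bigD1 i)//= (bigD1 j)//= -addrA lerDl.
  by rewrite addr_ge0//; do ?[apply: sumr_ge0 => ? _].
have hP beta (l : 'I_N) a : 0 <= a <= pi ->
    `|phi beta l a| <= P /\ `|derive1 (phi beta l) a| <= P.
  move=> ap; rewrite (phi_shift beta 1).
  have aI : `[0, pi]%classic a by rewrite /= in_itv.
  have s1 := supnorm_ub (@segment_compact R 0 pi)
    (continuous_subspaceT (cont_phi (beta := 1) (n := l))) aI.
  have s2 := supnorm_ub (@segment_compact R 0 pi)
    (continuous_subspaceT (cont_derive1_phi (beta := 1) (n := l))) aI.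
  have s0 f := supnorm_ge0 `[0, pi]%classic (f : R -> R).
  have sP : supnorm `[0, pi] (phi 1 l) + supnorm `[0, pi] (derive1 (phi 1 l)) <= P.
    by rewrite /P (bigD1 l)//= lerDl; apply: sumr_ge0 => i _; rewrite addr_ge0.
  split; first by apply: le_trans s1 (le_trans _ sP); rewrite lerDl.
  by apply: le_trans s2 (le_trans _ sP); rewrite lerDr.
have hV beta n k m : `|@v0hat R N K B1 beta n k m| <= V.
  have -> : @v0hat R N K B1 beta = v0hat B1 1.
    by rewrite /v0hat /Lambda /inner_C1 /Lambda_mx (phi_shift beta 1).
  exact: norm1_ub.
pose CQ := C_Q N K B1 B2 rad A d M P V; pose Cc := C_c N K B1 B2 rad A d M P V.
have CQ0 : 0 <= CQ by exact: (C_Q_ge0 rad hB hN hK hA hd (hM 1) (hP 1) (hV 1)).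
have Cc0 : 0 <= Cc by exact: (C_c_ge0 rad hB hN hK hA hd (hM 1) (hP 1) (hV 1)).
have T0 : 0 <= (N * K * K)%:R * CQ by rewrite mulr_ge0.
exists ((N * K * K)%:R * CQ + Cc + 1); split.
  by apply: ltr_wpDl; [exact: addr_ge0|exact: ltr01].
move=> beta _ p1 q1 p2 q2 [Cp1 _ Cq1 _ _] [Cp2 _ Cq2 _ _] _ _ pA1 pA2 qA1 qA2.
move=> Q1 Q2 b1 b2 sol1 sol2 c1 c2 hc1 hc2 delta.
have adm1 : admissible B1 B2 beta rad A d p1 q1 Q1 by split.
have adm2 : admissible B1 B2 beta rad A d p2 q2 Q2 by split.
have d0 : 0 <= delta by rewrite addr_ge0 ?C1norm_cube_ge0 ?C1norm_Ga_ge0.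
split.
  apply: (@le_trans _ _ ((N * K * K)%:R * (CQ * delta))).
    exact: (Q_stability hB1 hB hN hK hA hd (hM beta) (hP beta) (hV beta) adm1 adm2).
  by rewrite mulrA ler_wpM2r// -addrA lerDl addr_ge0.
apply: (@le_trans _ _ (Cc * delta)).
  exact: (c_stability hB1 hB hN hK hA hd (hM beta) (hP beta) (hV beta) adm1 adm2 hc1 hc2).
by rewrite ler_wpM2r// [_ + Cc]addrC -addrA lerDl addr_ge0.
Qed.
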